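(* Let $0<s<1$ be rational, let $E\subseteq2^\omega$ be a $\Sigma^1_1$ class with $\mathcal H^s(E)>0$, and let $y\in2^\omega$. If $y\le_T x$ for every $x\in2^\omega$ (equivalently, every oracle, including graphs of functions in $\omega^\omega$) such that $E$ has a $\Pi^0_1(x)$ subclass of non-zero $\mathcal H^s$-measure, then $y$ is hyperarithmetic.
   Context: Cantor space $2^\omega$ carries the metric $d(x,y)=2^{-\min\{n:x(n)\ne y(n)\}}$ for $x\ne y$; $\mathcal H^s$ denotes $s$-dimensional Hausdorff measure with respect to this metric. $\le_T$ is Turing reducibility. *)

(* Defs.v *)
From Stdlib Require Import Reals Lra Arith List QArith Qreals ClassicalEpsilon.
Import ListNotations.
Open Scope R_scope.

Definition cantor := nat -> bool.

Definition cdist (x y : cantor) : R :=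
  epsilon (inhabits 0) (fun r =>
    ((forall m, x m = y m) /\ r = 0) \/
    (exists n, (forall m, (m < n)%nat -> x m = y m) /\ x n <> y n /\ r = (/2) ^ n)).

Definition diam (A : cantor -> Prop) : R :=
  epsilon (inhabits 0) (fun r =>
    ((forall a, ~ A a) /\ r = 0) \/
    is_lub (fun t => exists a b, A a /\ A b /\ t = cdist a b) r).

Definition rpow0 (r s : R) : R := if Rle_dec r 0 then 0 else Rpower r s.

(** H^s(E) > 0, unfolded: for some delta > 0, H^s_delta(E) > 0, i.e. there is
    eps > 0 such that every countable delta-cover (U_i) of E has
    sum_i diam(U_i)^s >= eps (reached by some partial sum). *)
Definition Hs_pos (s : R) (E : cantor -> Prop) : Prop :=
  exists delta eps, 0 < delta /\ 0 < eps /\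
    forall U : nat -> (cantor -> Prop),
      (forall z, E z -> exists i, U i z) ->
      (forall i, diam (U i) <= delta) ->
      exists N, eps <= sum_f_R0 (fun i => rpow0 (diam (U i)) s) N.

Inductive code : Type :=
| cZero
| cSucc
| cProj (i : nat)
| cOracle
| cComp (f : code) (gs : list code)
| cPrec (f g : code)
| cMu (f : code).

Inductive eval (alpha : nat -> nat) : code -> list nat -> nat -> Prop :=
| eZero args : eval alpha cZero args 0
| eSucc args : eval alpha cSucc args (S (hd 0%nat args))
| eProj i args : eval alpha (cProj i) args (nth i args 0%nat)
| eOracle args : eval alpha cOracle args (alpha (hd 0%nat args))
| eComp f gs args vs r :
    evals alpha gs args vs -> eval alpha f vs r -> eval alpha (cComp f gs) args r
| ePrec0 f g rest r :
    eval alpha f rest r -> eval alpha (cPrec f g) (0%nat :: rest) r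
| ePrecS f g k rest r0 r :
    eval alpha (cPrec f g) (k :: rest) r0 ->
    eval alpha g (k :: r0 :: rest) r ->
    eval alpha (cPrec f g) (S k :: rest) r
| eMu f args n :
    eval alpha f (n :: args) 0%nat ->
    (forall m, (m < n)%nat -> exists v, eval alpha f (m :: args) (S v)) ->
    eval alpha (cMu f) args n
with evals (alpha : nat -> nat) : list code -> list nat -> list nat -> Prop :=
| esNil args : evals alpha nil args nil
| esCons g gs args v vs :
    eval alpha g args v -> evals alpha gs args vs -> evals alpha (g :: gs) args (v :: vs).

Definition halts (alpha : nat -> nat) (e : code) (args : list nat) : Prop :=
  exists r, eval alpha e args r.

Definition bseq (x : cantor) : nat -> nat := fun n => if x n then 1%nat else 0%nat.

Definition joinN (a b : nat -> nat) : nat -> nat :=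
  fun n => if Nat.even n then a (Nat.div2 n) else b (Nat.div2 n).

Definition turing_le (y x : cantor) : Prop :=
  exists e, forall n, eval (bseq x) e [n] (bseq y n).

(** Pi^0_1(x) class: complement of an x-effectively open class, i.e. the set
    of z on which a fixed oracle machine with oracle x (+) z diverges. *)
Definition Pi01_rel (x : cantor) (P : cantor -> Prop) : Prop :=
  exists e, forall z, P z <-> ~ halts (joinN (bseq x) (bseq z)) e nil.

(** (lightface) Sigma^1_1 class: projection along omega^omega of a Pi^0_1 class. *)
Definition Sigma11_class (E : cantor -> Prop) : Prop :=
  exists e, forall z, E z <-> exists f : nat -> nat, ~ halts (joinN (bseq z) f) e nil.

Definition Sigma11_nat (A : nat -> Prop) : Prop :=
  exists e, forall n, A n <-> exists f : nat -> nat, ~ halts f e [n].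

(** y is hyperarithmetic: Delta^1_1 (Kleene). *)
Definition hyperarithmetic (y : cantor) : Prop :=
  Sigma11_nat (fun n => y n = true) /\ Sigma11_nat (fun n => y n = false).

(* Main.v *)
(** By Davies' argument some [g] bounds witnesses on a subset of [E] of positive net
    content: the content of an increasing union is the limit of the contents, so witnesses
    can be bounded one coordinate at a time, and compactness passes to the limit.  Hence the
    class of functions [h] coding a tree whose paths all lie in [E], together with
    certificates for this inclusion and for the positive content of the set of paths, is a
    non-empty Pi^0_1 subset of Baire space.  Every tree so coded computes [y].  By the Baire
    category theorem a single machine succeeds on a dense subset of some non-empty basic
    neighbourhood in this class, so any value which it outputs there is the value of [y];
    this gives Sigma^1_1 definitions of both [y n = true] and [y n = false]. *)

Require Import Defs.
From Stdlib Require Import Reals Lra Lia ZArith Arith Cantor List QArith Qreals ClassicalEpsilon FunctionalExtensionality.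
Import ListNotations.
Open Scope R_scope.

(** That a tree has positive content and all its paths in [E] is not visibly an arithmetical
    condition; the certificates replace it by local equations between values of one function.
    Inclusion in [E]: each node carries an oracle on which [e0] has not halted within a clock equal
    to the level of the node; along a path these oracles have a limit point, because the odd entries
    are bounded by one function, and at the limit [e0] diverges. Positive content: for every height
    [N] there are numbers obeying the inequalities of the recursion for the cheapest cover, so no
    quantifier over covers occurs. To make these inequalities speak of natural numbers, $2^{-sl}$ is
    rounded to $2^{-\lfloor sl\rfloor}$, at the price of a factor 2; rationality of [s] makes the
    floor computable. The oracle from which [y] is computed is the tree alone, as a real. Category
    is needed since the machine may depend on the tree. In the neighbourhood that it provides, a
    computation at any member uses finitely many values, so it is repeated at a member where the
    machine computes [y]. *)

Section Computability.
Local Open Scope nat_scope.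

(** * Total functionals computable from an oracle *)

Fixpoint code_nested_ind (P : code -> Prop) (hZ : P cZero) (hS : P cSucc)
  (hP : forall i, P (cProj i)) (hO : P cOracle)
  (hC : forall f gs, P f -> Forall P gs -> P (cComp f gs))
  (hR : forall f g, P f -> P g -> P (cPrec f g)) (hM : forall f, P f -> P (cMu f))
  (e : code) {struct e} : P e :=
  let rc := code_nested_ind P hZ hS hP hO hC hR hM in
  match e with
  | cZero => hZ
  | cSucc => hS
  | cProj i => hP i
  | cOracle => hO
  | cComp f gs =>
      hC f gs (rc f)
        ((fix go (l : list code) : Forall P l :=
            match l with
            | nil => Forall_nil P
            | g :: l' => Forall_cons g (rc g) (go l')
            end) gs)
  | cPrec f g => hR f g (rc f) (rc g)
  | cMu f => hM f (rc f)
  end.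

Definition functional := (nat -> nat) -> list nat -> nat.

(** One code serves all oracles, and totality is built in. The arity is fixed because a list can be
    rebuilt from its projections, and so handed on to another code, only when its length is
    known. *)
Definition Comp (n : nat) (F : functional) : Prop :=
  exists c, forall al a, length a = n -> eval al c a (F al a).

Lemma comp_ext n (F G : functional) :
  (forall al a, length a = n -> F al a = G al a) -> Comp n F -> Comp n G.
Proof.
  intros H [c hc]. exists c. intros al a ha. rewrite <- H by assumption. now apply hc.
Qed.

Lemma comp_list n (Gs : list functional) :
  Forall (Comp n) Gs ->
  exists cs, forall al a, length a = n -> evals al cs a (map (fun G => G al a) Gs).
Proof.
  induction 1 as [|G Gs [c hc] _ [cs hcs]].
  - exists nil. constructor.
  - exists (c :: cs). intros al a ha. constructor; auto.
Qed.

Lemma comp_comp n F (Gs : list functional) :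
  Comp (length Gs) F -> Forall (Comp n) Gs ->
  Comp n (fun al a => F al (map (fun G => G al a) Gs)).
Proof.
  intros [c hc] H. destruct (comp_list n Gs H) as [cs hcs].
  exists (cComp c cs). intros al a ha. econstructor; [now apply hcs|].
  apply hc. now rewrite length_map.
Qed.

Lemma comp_nth n i : Comp n (fun _ a => nth i a 0).
Proof. exists (cProj i). constructor. Qed.

Lemma comp_hd n : Comp n (fun _ a => hd 0 a).
Proof.
  apply (comp_ext n (fun _ a => nth 0 a 0)); [|apply comp_nth]. now intros al [|x a].
Qed.

Lemma map_nth_seq (a : list nat) : map (fun i => nth i a 0) (seq 0 (length a)) = a.
Proof.
  induction a as [|x a IH]; [reflexivity|]. cbn [length seq map nth]. f_equal.
  rewrite <- seq_shift, map_map. exact IH.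
Qed.

Definition projections (k n : nat) : list functional :=
  map (fun i (_ : nat -> nat) a => nth i a 0) (seq k n).

Lemma projections_comp m k n : Forall (Comp m) (projections k n).
Proof.
  unfold projections. apply Forall_forall. intros G hG. apply in_map_iff in hG.
  destruct hG as [i [<- _]]. apply comp_nth.
Qed.

Lemma projections_length k n : length (projections k n) = n.
Proof. unfold projections. now rewrite length_map, length_seq. Qed.

Lemma projections_0 n al a : length a = n -> map (fun G => G al a) (projections 0 n) = a.
Proof. intros <-. unfold projections. rewrite map_map. apply map_nth_seq. Qed.

Lemma projections_1 n al a : length a = S n -> map (fun G => G al a) (projections 1 n) = tl a.
Proof.
  destruct a as [|x a]; [discriminate|]. intros [= <-]. unfold projections.
  rewrite <- seq_shift, !map_map. apply map_nth_seq.
Qed.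

Lemma projections_2 n al a :
  length a = S (S n) -> map (fun G => G al a) (projections 2 n) = tl (tl a).
Proof.
  destruct a as [|x [|x' a]]; try discriminate. intros [= <-]. unfold projections.
  rewrite <- !seq_shift, !map_map. apply map_nth_seq.
Qed.

Lemma comp_tl n F : Comp n F -> Comp (S n) (fun al a => F al (tl a)).
Proof.
  intros H. eapply comp_ext; [|apply (comp_comp (S n) F (projections 1 n))].
  - intros al a ha. cbn beta. now rewrite projections_1.
  - now rewrite projections_length.
  - apply projections_comp.
Qed.

(** A functional with an extra numerical argument is represented by passing that argument as head of
    the list. Below the recursion of [comp_prec] the list has two additional entries, so the head
    must be kept while the second entry is dropped. *)
Lemma comp_param n (H : (nat -> nat) -> list nat -> nat -> nat) :
  Comp (S n) (fun al a => H al (tl a) (hd 0 a)) ->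
  Comp (S (S n)) (fun al a => H al (tl (tl a)) (hd 0 a)).
Proof.
  intros h. eapply comp_ext; [|apply (comp_comp (S (S n)) (fun al a => H al (tl a) (hd 0 a))
    ((fun _ a => hd 0 a) :: projections 2 n) )].
  - intros al a ha. cbn [map]. rewrite projections_2 by assumption. reflexivity.
  - cbn [length]. rewrite projections_length. exact h.
  - constructor; [apply comp_hd|apply projections_comp].
Qed.

Lemma comp_param_subst n (H : (nat -> nat) -> list nat -> nat -> nat) G :
  Comp (S n) (fun al a => H al (tl a) (hd 0 a)) -> Comp n G ->
  Comp n (fun al a => H al a (G al a)).
Proof.
  intros h hG. eapply comp_ext; [|apply (comp_comp n (fun al a => H al (tl a) (hd 0 a))
    (G :: projections 0 n))].
  - intros al a ha. cbn [map]. now rewrite projections_0.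
  - cbn [length]. now rewrite projections_length.
  - constructor; [assumption|apply projections_comp].
Qed.

Lemma comp_prec n F (G : (nat -> nat) -> list nat -> nat -> nat -> nat) N :
  Comp n F -> Comp (S (S n)) (fun al a => G al (tl (tl a)) (hd 0 a) (hd 0 (tl a))) ->
  Comp n N -> Comp n (fun al a => nat_rect (fun _ => nat) (F al a) (G al a) (N al a)).
Proof.
  intros [f hf] [g hg] hN.
  destruct (comp_list n (N :: projections 0 n)) as [cs hcs].
  { constructor; [assumption|apply projections_comp]. }
  exists (cComp (cPrec f g) cs). intros al a ha.
  econstructor; [now apply hcs|]. cbn [map]. rewrite projections_0 by assumption.
  generalize (N al a) as k. induction k as [|k IH]; cbn [nat_rect].
  - constructor. now apply hf.
  - econstructor; [exact IH|].
    apply (hg al (k :: _ :: a)). cbn. now rewrite ha.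
Qed.

Lemma comp_S n F : Comp n F -> Comp n (fun al a => S (F al a)).
Proof.
  intros h. apply (comp_comp n (fun _ a => S (hd 0 a)) [F]).
  - exists cSucc. constructor.
  - now constructor.
Qed.

Lemma comp_const n k : Comp n (fun _ _ => k).
Proof.
  induction k as [|k IH]; [exists cZero; constructor|now apply comp_S].
Qed.

Lemma comp_oracle n F : Comp n F -> Comp n (fun al a => al (F al a)).
Proof.
  intros h. apply (comp_comp n (fun al a => al (hd 0 a)) [F]).
  - exists cOracle. constructor.
  - now constructor.
Qed.

Lemma comp_subst n (o : (nat -> nat) -> nat -> nat) F :
  Comp 1 (fun al a => o al (hd 0 a)) -> Comp n F -> Comp n (fun al a => o al (F al a)).
Proof.
  intros ho h. apply (comp_comp n (fun al a => o al (hd 0 a)) [F]); [exact ho|].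
  now constructor.
Qed.

Definition ifz (x y z : nat) : nat := match x with 0 => y | S _ => z end.

Lemma comp_ifz n F G H :
  Comp n F -> Comp n G -> Comp n H -> Comp n (fun al a => ifz (F al a) (G al a) (H al a)).
Proof.
  intros hF hG hH.
  apply (comp_ext n (fun al a => nat_rect (fun _ => nat) (G al a) (fun _ _ => H al a) (F al a))).
  - intros al a _. now destruct (F al a).
  - apply (comp_prec n G (fun al a _ _ => H al a)); try assumption. now repeat apply (comp_tl _ (fun al a => H al (tl a))) || apply comp_tl.
Qed.

Lemma comp_pred n F : Comp n F -> Comp n (fun al a => pred (F al a)).
Proof.
  intros hF.
  apply (comp_ext n (fun al a => nat_rect (fun _ => nat) 0 (fun k _ => k) (F al a))).
  - intros al a _. now destruct (F al a).
  - apply (comp_prec n (fun _ _ => 0) (fun _ _ k _ => k)); try assumption.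
    + apply comp_const.
    + apply comp_hd.
Qed.

Lemma comp_hd_tl n : Comp (S n) (fun _ a => hd 0 (tl a)).
Proof. apply (comp_tl n (fun _ a => hd 0 a)), comp_hd. Qed.

Lemma comp_add n F G : Comp n F -> Comp n G -> Comp n (fun al a => F al a + G al a).
Proof.
  intros hF hG.
  apply (comp_ext n (fun al a => nat_rect (fun _ => nat) (G al a) (fun _ r => S r) (F al a))).
  - intros al a _. induction (F al a) as [|k IH]; cbn; congruence.
  - apply (comp_prec n G (fun _ _ _ r => S r)); try assumption. apply comp_S, comp_hd_tl.
Qed.

Lemma comp_mul n F G : Comp n F -> Comp n G -> Comp n (fun al a => F al a * G al a).
Proof.
  intros hF hG.
  apply (comp_ext n (fun al a => nat_rect (fun _ => nat) 0 (fun _ r => G al a + r) (F al a))).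
  - intros al a _. induction (F al a) as [|k IH]; cbn; congruence.
  - apply (comp_prec n (fun _ _ => 0) (fun al a _ r => G al a + r)); try assumption.
    + apply comp_const.
    + apply comp_add; [|apply comp_hd_tl].
      now apply (comp_tl (S n) (fun al a => G al (tl a))), comp_tl.
Qed.

Lemma comp_sub n F G : Comp n F -> Comp n G -> Comp n (fun al a => F al a - G al a).
Proof.
  intros hF hG.
  apply (comp_ext n (fun al a => nat_rect (fun _ => nat) (F al a) (fun _ r => pred r) (G al a))).
  - intros al a _. induction (G al a) as [|k IH]; cbn; lia.
  - apply (comp_prec n F (fun _ _ _ r => pred r)); try assumption. apply comp_pred, comp_hd_tl.
Qed.

Lemma comp_pow2 n F : Comp n F -> Comp n (fun al a => 2 ^ F al a).
Proof.
  intros hF.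
  apply (comp_ext n (fun al a => nat_rect (fun _ => nat) 1 (fun _ r => r + r) (F al a))).
  - intros al a _. induction (F al a) as [|k IH]; cbn [nat_rect Nat.pow]; lia.
  - apply (comp_prec n (fun _ _ => 1) (fun _ _ _ r => r + r)); try assumption.
    + apply comp_const.
    + apply comp_add; apply comp_hd_tl.
Qed.

Definition bsum (f : nat -> nat) (n : nat) : nat :=
  nat_rect (fun _ => nat) 0 (fun k r => f k + r) n.

Lemma bsum_S f n : bsum f (S n) = f n + bsum f n.
Proof. reflexivity. Qed.

Lemma bsum_eq0 f n : bsum f n = 0 <-> forall k, k < n -> f k = 0.
Proof.
  induction n as [|n IH]; [split; [intros _ k hk; lia|reflexivity]|].
  rewrite bsum_S. split.
  - intros h k hk. destruct (Nat.eq_dec k n) as [->|]; [lia|]. apply IH; lia.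
  - intros h. rewrite (h n) by lia. apply IH. intros k hk. apply h. lia.
Qed.

Lemma comp_bsum n (F : (nat -> nat) -> list nat -> nat -> nat) N :
  Comp n N -> Comp (S n) (fun al a => F al (tl a) (hd 0 a)) ->
  Comp n (fun al a => bsum (F al a) (N al a)).
Proof.
  intros hN hF. unfold bsum.
  apply (comp_prec n (fun _ _ => 0) (fun al a k r => F al a k + r)); try assumption.
  - apply comp_const.
  - apply comp_add; [|apply comp_hd_tl]. now apply comp_param.
Qed.

(** The sum of a second component and a triangular number is literally how [to_nat] is defined, so
    the primitive recursion below agrees with it by conversion. *)
Lemma comp_pair n F G : Comp n F -> Comp n G -> Comp n (fun al a => to_nat (F al a, G al a)).
Proof.
  intros hF hG.
  apply (comp_ext n (fun al a => G al a +
    nat_rect (fun _ => nat) 0 (fun i m => S i + m) (G al a + F al a))); [reflexivity|].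
  apply comp_add; [assumption|].
  apply (comp_prec n (fun _ _ => 0) (fun _ _ i m => S i + m)).
  - apply comp_const.
  - apply comp_add; [apply comp_S, comp_hd|apply comp_hd_tl].
  - now apply comp_add.
Qed.

(** * A clocked evaluator *)

Lemma comp_product n Gs :
  Forall (Comp n) Gs ->
  Comp n (fun al a => fold_right Nat.mul 1 (map (fun G => G al a) Gs)).
Proof.
  induction 1 as [|G Gs h _ IH]; [exact (comp_const n 1)|].
  now apply (comp_mul n G (fun al a => fold_right Nat.mul 1 (map (fun G => G al a) Gs))).
Qed.

(* The value [0] stands for "undefined" and [S r] for the result [r]; the clock [t] only
   bounds the unbounded searches, so no other construct consumes time. *)
Fixpoint run (b : nat -> nat) (t : nat) (e : code) (args : list nat) {struct e} : nat :=
  match e with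
  | cZero => 1
  | cSucc => S (S (hd 0 args))
  | cProj i => S (nth i args 0)
  | cOracle => S (b (hd 0 args))
  | cComp f gs =>
      ifz (fold_right Nat.mul 1 (map (fun g => run b t g args) gs)) 0
        (run b t f (map (fun g => pred (run b t g args)) gs))
  | cPrec f g =>
      match args with
      | nil => 0
      | k :: rest =>
          nat_rect (fun _ => nat) (run b t f rest)
            (fun k r => ifz r 0 (run b t g (k :: pred r :: rest))) k
      end
  | cMu f =>
      pred (nat_rect (fun _ => nat) 0
        (fun m r => ifz r (ifz (run b t f (m :: args)) 1
                             (ifz (pred (run b t f (m :: args))) (S (S m)) 0)) r) t)
  end.

(** The code [e] is fixed, so induction on it builds a code for its own clocked simulation and no
    universal machine is required. The simulated oracle [H], the clock and the arguments may all
    depend on the parameters. *)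
Lemma comp_run e : forall n (H : (nat -> nat) -> list nat -> nat -> nat) T Gs,
  Comp (S n) (fun al a => H al (tl a) (hd 0 a)) -> Comp n T -> Forall (Comp n) Gs ->
  Comp n (fun al a => run (H al a) (T al a) e (map (fun G => G al a) Gs)).
Proof.
  induction e as [| |i| |f gs IHf IHgs|f g IHf IHg|f IHf] using code_nested_ind;
    intros n H T Gs hH hT hGs; cbn [run].
  - apply comp_const.
  - apply comp_S, comp_S. destruct hGs; [exact (comp_const n 0)|assumption].
  - apply comp_S. revert i. induction hGs as [|G Gs hG _ IH]; intros [|i]; cbn [map nth];
      [exact (comp_const n 0)|exact (comp_const n 0)|assumption|apply IH].
  - apply comp_S. destruct hGs as [|G Gs hG _]; cbn [map hd].
    + exact (comp_param_subst n H (fun _ _ => 0) hH (comp_const n 0)).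
    + exact (comp_param_subst n H G hH hG).
  (* The product of the clocked values of the arguments vanishes exactly when one of them is
     undefined, which is the test made before [f] is run. *)
  - set (Rs := map (fun g al a => run (H al a) (T al a) g (map (fun G => G al a) Gs)) gs).
    assert (hRs : Forall (Comp n) Rs).
    { unfold Rs. apply Forall_forall. intros R hR. apply in_map_iff in hR.
      destruct hR as [g [<- hg]]. rewrite Forall_forall in IHgs. now apply IHgs. }
    apply comp_ifz; [|apply comp_const|].
    + eapply comp_ext; [|exact (comp_product n Rs hRs)].
      intros al a _. unfold Rs. cbn beta. now rewrite map_map.
    + eapply comp_ext; [|apply (IHf n H T (map (fun R al a => pred (R al a)) Rs))];
        try assumption.
      * intros al a _. unfold Rs. cbn beta. now rewrite !map_map.
      * apply Forall_map. eapply Forall_impl; [|exact hRs]. intros R hR. now apply comp_pred.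
  - destruct hGs as [|G Gs hG hGs]; cbn [map]; [exact (comp_const n 0)|].
    apply (comp_prec n
      (fun al a => run (H al a) (T al a) f (map (fun G => G al a) Gs))
      (fun al a k r => ifz r 0 (run (H al a) (T al a) g
          (k :: pred r :: map (fun G => G al a) Gs))) G); [now apply IHf| |assumption].
    apply comp_ifz; [apply comp_hd_tl|apply comp_const|].
    eapply comp_ext; [|apply (IHg (S (S n)) (fun al a => H al (tl (tl a)))
      (fun al a => T al (tl (tl a)))
      ((fun _ a => hd 0 a) :: (fun _ a => pred (hd 0 (tl a))) ::
        map (fun (G : functional) al a => G al (tl (tl a))) Gs))].
    + intros al a _. cbn [map]. now rewrite map_map.
    + apply (comp_param (S n) (fun al a => H al (tl a))), comp_param, hH.
    + now apply (comp_tl (S n) (fun al a => T al (tl a))), comp_tl.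
    + constructor; [apply comp_hd|]. constructor; [apply comp_pred, comp_hd_tl|].
      apply Forall_map. eapply Forall_impl; [|exact hGs]. intros F hF.
      now apply (comp_tl (S n) (fun al a => F al (tl a))), comp_tl.
  - assert (hf : Comp (S (S n)) (fun al a => run (H al (tl (tl a))) (T al (tl (tl a))) f
        (hd 0 a :: map (fun G => G al (tl (tl a))) Gs))).
    { eapply comp_ext; [|apply (IHf (S (S n)) (fun al a => H al (tl (tl a)))
        (fun al a => T al (tl (tl a)))
        ((fun _ a => hd 0 a) :: map (fun (G : functional) al a => G al (tl (tl a))) Gs))].
      + intros al a _. cbn [map]. now rewrite map_map.
      + apply (comp_param (S n) (fun al a => H al (tl a))), comp_param, hH.
      + now apply (comp_tl (S n) (fun al a => T al (tl a))), comp_tl.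
      + constructor; [apply comp_hd|].
        apply Forall_map. eapply Forall_impl; [|exact hGs]. intros F hF.
        now apply (comp_tl (S n) (fun al a => F al (tl a))), comp_tl. }
    apply comp_pred.
    apply (comp_prec n (fun _ _ => 0) (fun al a m r =>
      ifz r (ifz (run (H al a) (T al a) f (m :: map (fun G => G al a) Gs)) 1
         (ifz (pred (run (H al a) (T al a) f (m :: map (fun G => G al a) Gs))) (S (S m)) 0)) r));
      [apply comp_const| |assumption].
    apply comp_ifz; [apply comp_hd_tl| |apply comp_hd_tl].
    apply comp_ifz; [exact hf|apply comp_const|].
    apply comp_ifz; [now apply comp_pred|apply comp_S, comp_S, comp_hd|apply comp_const].
Qed.

Lemma run_sound b t e : forall args r, run b t e args = S r -> eval b e args r.
Proof.
  induction e as [| |i| |f gs IHf IHgs|f g IHf IHg|f IHf] using code_nested_ind;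
    intros args r; cbn [run].
  - intros [= <-]. constructor.
  - intros [= <-]. constructor.
  - intros [= <-]. constructor.
  - intros [= <-]. constructor.
  - intros h. destruct (fold_right Nat.mul 1 (map (fun g => run b t g args) gs)) eqn:hp;
      [discriminate|]. cbn [ifz] in h. econstructor; [|apply IHf, h].
    assert (hnz : fold_right Nat.mul 1 (map (fun g => run b t g args) gs) <> 0) by lia.
    clear h hp IHf. induction IHgs as [|g gs hg _ IH]; cbn in *; constructor.
    + apply hg. destruct (run b t g args); cbn in *; lia.
    + apply IH. lia.
  - destruct args as [|k rest]; [discriminate|]. revert r.
    induction k as [|k IHk]; cbn [nat_rect]; intros r h.
    + constructor. now apply IHf.
    + destruct (nat_rect (fun _ => nat) (run b t f rest)
            (fun k r => ifz r 0 (run b t g (k :: pred r :: rest))) k) as [|q] eqn:hq;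
        cbn [ifz pred] in h; [discriminate|].
      econstructor; [apply IHk; reflexivity|]. now apply IHg.
  (* States of the search: [0] means that no zero has been met so far, [1] that an undefined value
     blocked the search, and [S (S m)] that the first zero is at [m]. The final [pred] sends both
     failures to [0]. *)
  - set (step := fun m q => ifz q (ifz (run b t f (m :: args)) 1
                     (ifz (pred (run b t f (m :: args))) (S (S m)) 0)) q).
    assert (inv : forall T,
      (nat_rect (fun _ => nat) 0 step T = 0 ->
        forall m, m < T -> exists v, eval b f (m :: args) (S v)) /\
      (forall q, nat_rect (fun _ => nat) 0 step T = S (S q) -> eval b (cMu f) args q)).
    { induction T as [|T [IH0 IH1]]; cbn [nat_rect]; [split; [lia|discriminate]|].
      destruct (nat_rect (fun _ => nat) 0 step T) as [|q0]; cbn [step ifz].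
      2:{ split; [discriminate|exact IH1]. }
      specialize (IH0 eq_refl).
      destruct (run b t f (T :: args)) as [|[|v]] eqn:hv; cbn [ifz pred].
      + split; [discriminate|]. intros q [=].
      + split; [discriminate|]. intros q [= <-]. constructor; [now apply IHf|exact IH0].
      + split; [|discriminate]. intros _ m hm. destruct (Nat.eq_dec m T) as [->|].
        * exists v. now apply IHf.
        * apply IH0. lia. }
    intros h. apply (proj2 (inv t)).
    destruct (nat_rect (fun _ => nat) 0 step t); cbn in h; [discriminate|]. now rewrite h.
Qed.

(** * Finite use, determinism and unbounded search *)

Definition agree (u : nat) (a b : nat -> nat) : Prop := forall i, i < u -> b i = a i.

Lemma agree_le u v a b : u <= v -> agree v a b -> agree u a b.
Proof. intros h H i hi. apply H. lia. Qed.

Local Ltac agr := solve [lia | eapply agree_le; [|eassumption]; lia].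

(** A derivation is finite, so it inspects finitely many oracle values and performs finitely many
    searches. One number [u] bounds both, and bounds of subcomputations are simply added. *)
Lemma eval_run al e : forall args r,
  eval al e args r ->
  exists u, forall t b, u <= t -> agree u al b -> run b t e args = S r.
Proof.
  induction e as [| |i| |f gs IHf IHgs|f g IHf IHg|f IHf] using code_nested_ind;
    intros args r h.
  - inversion h; subst. now exists 0.
  - inversion h; subst. now exists 0.
  - inversion h; subst. now exists 0.
  - inversion h; subst. exists (S (hd 0 args)). intros t b _ hb. cbn. f_equal. apply hb. lia.
  - inversion h as [| | | |? ? ? vs ? hgs hf| | |]; subst.
    assert (h2 : exists u, forall t b, u <= t -> agree u al b ->
       map (fun g => run b t g args) gs = map S vs).
    { clear hf h IHf. revert vs hgs. induction IHgs as [|g gs hg _ IH]; intros vs hgs;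
        inversion hgs; subst; [now exists 0|].
      match goal with H1 : eval _ g _ _, H2 : evals _ gs _ _ |- _ =>
        destruct (hg _ _ H1) as [u1 h1], (IH _ H2) as [u2 h2] end.
      exists (u1 + u2). intros t b ht hb. cbn [map].
      f_equal; [apply h1|apply h2]; agr. }
    destruct h2 as [u2 h2], (IHf _ _ hf) as [u1 h1]. exists (u1 + u2). intros t b ht hb.
    cbn [run]. rewrite <- (map_map (fun g => run b t g args) pred gs).
    rewrite h2 by agr.
    replace (map Nat.pred (map S vs)) with vs by (clear; induction vs; cbn; congruence).
    destruct (fold_right Nat.mul 1 (map S vs)) eqn:hp.
    + exfalso. clear - hp. induction vs; cbn in hp; lia.
    + cbn [ifz]. apply h1; agr.
  - destruct args as [|k rest]; [inversion h|]. revert r h.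
    induction k as [|k IHk]; intros r h; inversion h; subst.
    + match goal with H : eval _ f _ _ |- _ => destruct (IHf _ _ H) as [u hu] end.
      exists u. intros t b ht hb. cbn. now apply hu.
    + match goal with H1 : eval _ (cPrec f g) _ _, H2 : eval _ g _ _ |- _ =>
        destruct (IHk _ H1) as [u1 h1], (IHg _ _ H2) as [u2 h2] end.
      exists (u1 + u2). intros t b ht hb.
      cbn [run nat_rect]. specialize (h1 t b). cbn [run] in h1.
      rewrite h1 by agr. cbn [ifz pred].
      apply h2; agr.
  - inversion h as [| | | | | | |? ? ? h1 h2]; subst.
    destruct (IHf _ _ h1) as [u1 h3].
    (* Only finitely many values precede the zero at [r], so one bound serves all of them. *)
    assert (h4 : forall q, q <= r -> exists u2, forall m, m < q ->
       exists v, forall t b, u2 <= t -> agree u2 al b -> run b t f (m :: args) = S (S v)).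
    { induction q as [|q IHq]; intros hq; [exists 0; lia|].
      destruct IHq as [u2 hu2]; [lia|]. destruct (h2 q) as [v hv]; [lia|].
      destruct (IHf _ _ hv) as [u4 hu4]. exists (u2 + u4). intros m hm.
      destruct (Nat.eq_dec m q) as [->|].
      - exists v. intros t b ht hb. apply hu4; agr.
      - destruct (hu2 m) as [v' hv']; [lia|]. exists v'. intros t b ht hb.
        apply hv'; agr. }
    destruct (h4 r (le_n _)) as [u2 hu2]. exists (u1 + u2 + S r). intros t b ht hb.
    cbn [run].
    set (step := fun m q => ifz q (ifz (run b t f (m :: args)) 1
                     (ifz (pred (run b t f (m :: args))) (S (S m)) 0)) q).
    assert (i1 : forall q, q <= r -> nat_rect (fun _ => nat) 0 step q = 0).
    { induction q as [|q IHq]; intros hq; [reflexivity|]. cbn [nat_rect].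
      rewrite IHq by lia. unfold step. cbn [ifz]. destruct (hu2 q) as [v hv]; [lia|].
      rewrite hv; solve [reflexivity|agr]. }
    assert (i2 : forall q, nat_rect (fun _ => nat) 0 step (S r + q) = S (S r)).
    { induction q as [|q IHq].
      - rewrite Nat.add_0_r. cbn [nat_rect]. rewrite i1 by lia. unfold step. cbn [ifz].
        rewrite h3; solve [reflexivity|agr].
      - rewrite Nat.add_succ_r. cbn [nat_rect]. rewrite IHq. reflexivity. }
    replace t with (S r + (t - S r)) at 1 by lia.
    rewrite i2. reflexivity.
Qed.

(** The clocked evaluator is a function, and with a large enough clock it returns both results. *)
Lemma eval_det al e args r r' : eval al e args r -> eval al e args r' -> r = r'.
Proof.
  intros h h'. destruct (eval_run _ _ _ _ h) as [u hu], (eval_run _ _ _ _ h') as [u' hu'].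
  specialize (hu (u + u') al). specialize (hu' (u + u') al).
  assert (S r = S r'); [|congruence].
  rewrite <- hu, <- hu'; unfold agree; auto; lia.
Qed.

Lemma comp_continuous n F al a :
  Comp n F -> length a = n -> exists u, forall b, agree u al b -> F b a = F al a.
Proof.
  intros [c hc] ha. destruct (eval_run _ _ _ _ (hc al a ha)) as [u hu].
  exists u. intros b hb. apply (eval_det b c a); [now apply hc|].
  apply (run_sound b u), hu; [lia|assumption].
Qed.

(** Minimization looks for zeros, so it is applied to [1 - F]. Negating the equivalence gives the
    form in which both [Pi01_rel] and [Sigma11_nat] are stated: a machine that diverges when a
    computable functional vanishes everywhere. *)
Lemma comp_search n F :
  Comp (S n) F -> exists e, forall al a, length a = n ->
    (halts al e a <-> exists t, F al (t :: a) <> 0).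
Proof.
  intros hF.
  assert (h1 : Comp (S n) (fun al a => 1 - F al a)) by (apply comp_sub; [apply comp_const|exact hF]).
  destruct h1 as [c hc]. exists (cMu c). intros al a ha. split.
  - intros [r hr]. inversion hr as [| | | | | | |? ? ? h1 _]; subst. exists r.
    assert (0 = 1 - F al (r :: a)); [|lia].
    apply (eval_det al c (r :: a)); [assumption|]. apply hc. reflexivity.
  - intros [t ht]. destruct (dec_inh_nat_subset_has_unique_least_element
      (fun t => F al (t :: a) <> 0)) as [m [[hm hmin] _]].
    + intros k. destruct (Nat.eq_dec (F al (k :: a)) 0); [right|left]; lia.
    + now exists t.
    + exists m. constructor.
      * replace 0 with (1 - F al (m :: a)) by lia. apply hc. cbn. now rewrite ha.
      * intros k hk. exists 0. replace 1 with (1 - F al (k :: a)).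
        -- apply hc. cbn. now rewrite ha.
        -- destruct (Nat.eq_dec (F al (k :: a)) 0) as [->|hne]; [reflexivity|].
           specialize (hmin k hne). lia.
Qed.

(** Only injectivity is used: it arranges the codes as the requirements numbered 0, 1, 2, ... of the
    category argument. *)
Fixpoint code_number (e : code) : nat :=
  match e with
  | cZero => to_nat (0, 0)
  | cSucc => to_nat (1, 0)
  | cProj i => to_nat (2, i)
  | cOracle => to_nat (3, 0)
  | cComp f gs =>
      to_nat (4, to_nat (code_number f,
        fold_right (fun g k => S (to_nat (g, k))) 0 (map code_number gs)))
  | cPrec f g => to_nat (5, to_nat (code_number f, code_number g))
  | cMu f => to_nat (6, code_number f)
  end.

#[local] Opaque to_nat of_nat.

Lemma code_number_inj e e' : code_number e = code_number e' -> e = e'.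
Proof.
  revert e'.
  induction e as [| |i| |f gs IHf IHgs|f g IHf IHg|f IHf] using code_nested_ind;
    intros [| |i'| |f' gs'|f' g'|f'] h; cbn [code_number] in h;
    apply to_nat_inj in h; try discriminate h; try reflexivity; injection h; clear h;
    intros; subst; try reflexivity.
  - match goal with H : to_nat _ = to_nat _ |- _ => apply to_nat_inj in H; injection H; clear H end.
    intros h2 h1. apply IHf in h1. subst f'. f_equal. revert gs' h2.
    induction IHgs as [|g gs hg _ IH]; intros [|g' gs'] h2; cbn [map fold_right] in h2;
      try reflexivity; try discriminate h2.
    injection h2 as h2. apply to_nat_inj in h2. injection h2 as h2 h3.
    f_equal; auto.
  - match goal with H : to_nat _ = to_nat _ |- _ => apply to_nat_inj in H; injection H; clear H end.
    intros h2 h1. f_equal; auto.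
  - f_equal; auto.
Qed.

End Computability.

(** * Sequences built by finite approximation, and binary strings as numbers *)

Section Sequences.
Local Open Scope nat_scope.

Definition upd (g : nat -> nat) (k v : nat) : nat -> nat :=
  fun i => if i =? k then v else g i.

Lemma upd_eq g k v : upd g k v k = v.
Proof. unfold upd. now rewrite Nat.eqb_refl. Qed.

Lemma upd_lt g k v i : i < k -> upd g k v i = g i.
Proof. intros h. unfold upd. destruct (Nat.eqb_spec i k); [lia|reflexivity]. Qed.

(** Stage [S u] changes nothing below [u], so the diagonal of the stages agrees with stage [u] below
    [u]; the first hypothesis says that [P g u] depends on no more than that. *)
Lemma choose_sequence (P : (nat -> nat) -> nat -> Prop) g0 :
  (forall g g' u, agree u g g' -> P g u -> P g' u) ->
  P g0 0 -> (forall g u, P g u -> exists v, P (upd g u v) (S u)) ->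
  exists g, forall u, P g u.
Proof.
  intros hP h0 hS.
  pose (gs := nat_rect (fun _ => nat -> nat) g0
    (fun u g => upd g u (epsilon (inhabits 0) (fun v => P (upd g u v) (S u))))).
  assert (h1 : forall u, P (gs u) u).
  { induction u as [|u IH]; [exact h0|].
    apply (epsilon_spec (inhabits 0) (fun v => P (upd (gs u) u v) (S u))), hS, IH. }
  assert (h2 : forall u i, i < u -> gs u i = gs (S i) i).
  { induction u as [|u IH]; intros i hi; [lia|].
    destruct (Nat.eq_dec i u) as [->|]; [reflexivity|].
    rewrite <- IH by lia. cbn [gs nat_rect]. apply upd_lt. lia. }
  exists (fun i => gs (S i) i). intros u. apply (hP (gs u)); [|apply h1].
  intros i hi. symmetry. now apply h2.
Qed.

(** Pigeonhole, one coordinate at a time: if an initial segment recurs for arbitrarily large [k],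
    one of the finitely many values up to [G u] recurs along with it. A bound below the diagonal is
    enough because finitely many [k] can be discarded. *)
Lemma konig (hs : nat -> nat -> nat) (G : nat -> nat) :
  (forall k i, i < k -> hs k i <= G i) ->
  exists h, forall u k0, exists k, k0 <= k /\ agree u h (hs k).
Proof.
  intros hG.
  apply (choose_sequence (fun h u => forall k0, exists k, k0 <= k /\ agree u h (hs k))
    (fun _ => 0)).
  - intros g g' u hg h k0. destruct (h k0) as [k [hk ha]]. exists k. split; [assumption|].
    intros i hi. rewrite ha, hg by assumption. reflexivity.
  - intros k0. exists k0. split; [lia|]. intros i hi. lia.
  - intros h u H. apply NNPP. intros hn.
    (* If no value recurs, then each value below [q] stops occurring after some stage; with [q]
       beyond [G u] nothing is left. *)
    assert (hb : forall q, exists k1, forall k v, k1 <= k -> v < q -> agree u h (hs k) ->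
       hs k u <> v).
    { induction q as [|q [k1 IH]]; [exists 0; lia|].
      assert (hq : ~ forall k0, exists k, k0 <= k /\ agree (S u) (upd h u q) (hs k)).
      { intros hq. apply hn. now exists q. }
      apply not_all_ex_not in hq. destruct hq as [k2 hk2]. exists (k1 + k2).
      intros k v hk hv ha hu. destruct (Nat.eq_dec v q) as [->|].
      - apply hk2. exists k. split; [lia|]. intros i hi.
        destruct (Nat.eq_dec i u) as [->|]; [now rewrite upd_eq|].
        rewrite upd_lt by lia. apply ha. lia.
      - apply (IH k v); [lia|lia|assumption|assumption]. }
    destruct (hb (S (G u))) as [k1 hk1]. destruct (H (k1 + S u)) as [k [hk ha]].
    apply (hk1 k (hs k u)); [lia| |assumption|reflexivity].
    specialize (hG k u). lia.
Qed.

(** Bits are written with the lowest first, so the two children of the string of length [l] coded by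
    [j] are coded by [j] and [j + 2 ^ l]. *)
Definition binval (f : nat -> nat) (l : nat) : nat := bsum (fun k => f k * 2 ^ k) l.

Lemma binval_S f l : binval f (S l) = f l * 2 ^ l + binval f l.
Proof. reflexivity. Qed.

Lemma binval_ext f g l : agree l f g -> binval f l = binval g l.
Proof.
  induction l as [|l IH]; intros h; [reflexivity|]. rewrite !binval_S, (h l) by lia.
  f_equal. apply IH. intros i hi. apply h. lia.
Qed.

Lemma binval_lt f l : (forall k, k < l -> f k <= 1) -> binval f l < 2 ^ l.
Proof.
  induction l as [|l IH]; intros h; [cbn; lia|]. rewrite binval_S.
  specialize (IH ltac:(intros k hk; apply h; lia)). pose proof (h l ltac:(lia)).
  cbn [Nat.pow]. nia.
Qed.

Lemma binval_inj f g l :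
  (forall k, k < l -> f k <= 1) -> (forall k, k < l -> g k <= 1) ->
  binval f l = binval g l -> agree l f g.
Proof.
  induction l as [|l IH]; intros hf hg h; [intros i hi; lia|].
  rewrite !binval_S in h.
  assert (hf' : forall k, k < l -> f k <= 1) by (intros k hk; apply hf; lia).
  assert (hg' : forall k, k < l -> g k <= 1) by (intros k hk; apply hg; lia).
  pose proof (binval_lt f l hf'). pose proof (binval_lt g l hg').
  pose proof (hf l ltac:(lia)). pose proof (hg l ltac:(lia)).
  assert (f l = g l) by nia.
  intros i hi. destruct (Nat.eq_dec i l) as [->|]; [congruence|].
  apply IH; try assumption; [nia|lia].
Qed.

Lemma bseq_le1 z k : bseq z k <= 1.
Proof. unfold bseq. destruct (z k); lia. Qed.

Lemma bseq_inj z z' k : bseq z k = bseq z' k -> z k = z' k.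
Proof. unfold bseq. now destruct (z k), (z' k). Qed.

Lemma binval_bseq z z' l :
  binval (bseq z) l = binval (bseq z') l <-> (forall k, k < l -> z k = z' k).
Proof.
  split.
  - intros h k hk. symmetry. apply bseq_inj.
    apply (binval_inj _ _ l); try assumption; intros; apply bseq_le1.
  - intros h. apply binval_ext. intros i hi. unfold bseq. now rewrite h.
Qed.

End Sequences.

(** * Nodes and the content of sets under weighted covers *)

Definition node : Type := (nat * nat)%type.

(** The node [(l, j)] stands for a cylinder. If [j] is at least [2 ^ l], that cylinder is empty,
    which is harmless in a cover. *)
Definition within (z : cantor) (n : node) : Prop := binval (bseq z) (fst n) = snd n.

Lemma within_shorter z z' n l :
  (fst n <= l)%nat -> binval (bseq z) l = binval (bseq z') l -> within z n -> within z' n.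
Proof.
  unfold within. intros hl h <-. apply binval_bseq. intros k hk. symmetry.
  apply (proj1 (binval_bseq z z' l) h). lia.
Qed.

Definition decide (P : Prop) : bool := if excluded_middle_informative P then true else false.

Lemma decide_true P : decide P = true <-> P.
Proof. unfold decide. destruct (excluded_middle_informative P); cbn; easy. Qed.

Lemma decide_false P : negb (decide P) = true <-> ~ P.
Proof. unfold decide. destruct (excluded_middle_informative P); cbn; easy. Qed.

Lemma choice_fun {A B : Type} (R : A -> B -> Prop) :
  (forall x, exists y, R x y) -> exists f, forall x, R x (f x).
Proof.
  intros h. exists (fun x => proj1_sig (constructive_indefinite_description _ (h x))).
  intros x. exact (proj2_sig (constructive_indefinite_description _ (h x))).
Qed.

Section Content.
Variable w : nat -> R.
Hypothesis w_pos : forall l, 0 <= w l.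

Definition wsum (L : list node) : R := fold_right Rplus 0 (map (fun n => w (fst n)) L).

Lemma wsum_nonneg L : 0 <= wsum L.
Proof.
  induction L as [|n L IH]; cbn; [lra|]. specialize (w_pos (fst n)). fold (wsum L). lra.
Qed.

Lemma wsum_cons n L : wsum (n :: L) = w (fst n) + wsum L.
Proof. reflexivity. Qed.

Lemma wsum_app L L' : wsum (L ++ L') = wsum L + wsum L'.
Proof. induction L as [|n L IH]; cbn [app]; rewrite ?wsum_cons; [cbn; lra|lra]. Qed.

Lemma wsum_filter f L : wsum L = wsum (filter f L) + wsum (filter (fun n => negb (f n)) L).
Proof.
  induction L as [|n L IH]; [cbn; lra|]. cbn [filter]. rewrite wsum_cons.
  destruct (f n); cbn [negb]; rewrite wsum_cons; lra.
Qed.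

Lemma wsum_incl L L' : NoDup L -> incl L L' -> wsum L <= wsum L'.
Proof.
  intros hL. revert L'. induction hL as [|n L hn hL IH]; intros L' h; [apply wsum_nonneg|].
  destruct (in_split n L') as [L1 [L2 ->]]; [apply h; now left|].
  rewrite wsum_cons, wsum_app, wsum_cons.
  specialize (IH (L1 ++ L2)). rewrite wsum_app in IH.
  assert (incl L (L1 ++ L2)) as h'.
  { intros m hm. specialize (h m (or_intror hm)). apply in_app_iff. apply in_app_iff in h.
    destruct h as [h|[h|h]]; auto. subst. contradiction. }
  specialize (IH h'). lra.
Qed.

Lemma wsum_in n L : In n L -> w (fst n) <= wsum L.
Proof.
  intros h. replace (w (fst n)) with (wsum [n]) by (cbn; lra).
  apply wsum_incl; [repeat constructor; easy|]. now intros m [<-|[]].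
Qed.

(** The sum over a possibly infinite cover is expressed through its finite parts without repetition.
    The lengths of the nodes are unrestricted, so this is a content rather than a measure. The
    infimum over covers need not be attained, hence the slack [eta] in later statements. *)
Definition content_le (A : cantor -> Prop) (r : R) : Prop :=
  exists C : node -> Prop,
    (forall z, A z -> exists n, C n /\ within z n) /\
    (forall L, NoDup L -> (forall n, In n L -> C n) -> wsum L <= r).

Lemma content_le_mono (A B : cantor -> Prop) r r' :
  (forall z, A z -> B z) -> r <= r' -> content_le B r -> content_le A r'.
Proof.
  intros h hr [C [h1 h2]]. exists C. split; [auto|]. intros L hL hC.
  specialize (h2 L hL hC). lra.
Qed.

Lemma content_le_nonneg A r : content_le A r -> 0 <= r.
Proof. intros [C [_ h]]. apply (h nil); [constructor|easy]. Qed.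

Lemma content_inf A r :
  content_le A r ->
  exists mu, (forall r, content_le A r -> mu <= r) /\
             (forall eta, 0 < eta -> content_le A (mu + eta)).
Proof.
  intros hr.
  destruct (completeness (fun x => content_le A (- x))) as [m [hm1 hm2]].
  - exists 0. intros x hx. apply content_le_nonneg in hx. lra.
  - exists (- r). now rewrite Ropp_involutive.
  - exists (- m). split.
    + intros x hx. enough (- x <= m) by lra. apply hm1. now rewrite Ropp_involutive.
    + intros eta he. apply NNPP. intros hn.
      assert (m <= m - eta); [|lra]. apply hm2. intros x hx.
      destruct (Rle_dec x (m - eta)); [assumption|]. exfalso. apply hn.
      eapply content_le_mono; [| |exact hx]; [auto|lra].
Qed.

Definition above (y x : node) : Prop :=
  (fst y < fst x)%nat /\ forall z, within z x -> within z y.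

Definition minimal (U : node -> Prop) (x : node) : Prop :=
  U x /\ forall y, U y -> ~ above y x.

Lemma minimal_covers (U : node -> Prop) z x :
  U x -> within z x -> exists y, minimal U y /\ within z y.
Proof.
  remember (fst x) as l eqn:hl. revert x hl.
  induction l as [l IH] using lt_wf_ind. intros x -> hx hz.
  destruct (excluded_middle_informative (exists y, U y /\ above y x)) as [[y [hy ha]]|hn].
  - apply (IH (fst y)) with (x := y); try easy; [apply ha|]. now apply ha.
  - exists x. repeat split; try assumption. intros y hy ha. apply hn. now exists y.
Qed.

(* Strong subadditivity: the sum of the weights of [D] and [C] dominates the weight of the
   minimal nodes of the union plus that of the nodes common to both or non-minimal, and
   the latter still cover every set covered by both families. *)
Lemma union_content (A : cantor -> Prop) (D C : node -> Prop) mu a b L :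
  (forall r, content_le A r -> mu <= r) ->
  (forall z, A z -> exists n, D n /\ within z n) ->
  (forall z, A z -> exists n, C n /\ within z n) ->
  (forall L, NoDup L -> (forall n, In n L -> D n) -> wsum L <= a) ->
  (forall L, NoDup L -> (forall n, In n L -> C n) -> wsum L <= b) ->
  NoDup L -> (forall n, In n L -> minimal (fun x => D x \/ C x) n) ->
  wsum L + mu <= a + b.
Proof.
  intros hmu hD hC ha hb hL hmin.
  set (I := fun x => (D x \/ C x) /\ (D x /\ C x \/ exists y, (D y \/ C y) /\ above y x)).
  enough (hI : mu <= a + b - wsum L) by lra.
  apply hmu. exists I. split.
  - intros z hz. destruct (hD z hz) as [d [h1 h2]], (hC z hz) as [c [h3 h4]].
    destruct (lt_eq_lt_dec (fst d) (fst c)) as [[hlt|heq]|hlt].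
    + exists c. repeat split; auto. right. exists d. repeat split; auto.
      intros z' hz'. apply (within_shorter z z' d (fst c)); [lia| |assumption].
      now rewrite hz', h4.
    + exists c. repeat split; auto. left. split; [|assumption].
      replace c with d; [assumption|]. destruct d as [ld jd], c as [lc jc].
      unfold within in *. cbn in *. subst. reflexivity.
    + exists d. repeat split; auto. right. exists c. repeat split; auto.
      intros z' hz'. apply (within_shorter z z' c (fst d)); [lia| |assumption].
      now rewrite hz', h2.
  - intros L2 hL2 hI.
    set (inD := fun x => decide (D x)). set (inC := fun x => decide (C x)).
    (* A node of both lists is minimal and hence lies in [D] and [C]. So the parts of [L] and [L2]
       can be recombined crosswise into a list in [D] and a list in [C], neither with repetitions,
       of the same total weight. *)
    assert (hexcl : forall x, In x L -> In x L2 -> D x /\ C x).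
    { intros x h1 h2. destruct (hI x h2) as [_ [h|[y [hy hab]]]]; [assumption|].
      now destruct (proj2 (hmin x h1) y hy). }
    assert (h1 : wsum (filter inD L ++ filter (fun n => negb (inC n)) L2) <= a).
    { apply ha.
      - apply NoDup_app; try now apply NoDup_filter.
        intros x hx hx'. apply filter_In in hx, hx'.
        destruct hx as [hx _], hx' as [hx' hc]. apply decide_false in hc.
        apply hc. now apply hexcl.
      - intros x hx. apply in_app_iff in hx. destruct hx as [hx|hx]; apply filter_In in hx.
        + now apply decide_true.
        + destruct hx as [hx hc]. apply decide_false in hc. destruct (hI x hx) as [[h|h] _]; tauto. }
    assert (h2 : wsum (filter (fun n => negb (inD n)) L ++ filter inC L2) <= b).
    { apply hb.
      - apply NoDup_app; try now apply NoDup_filter.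
        intros x hx hx'. apply filter_In in hx, hx'.
        destruct hx as [hx hd], hx' as [hx' _]. apply decide_false in hd.
        apply hd. now apply hexcl.
      - intros x hx. apply in_app_iff in hx. destruct hx as [hx|hx]; apply filter_In in hx.
        + destruct hx as [hx hd]. apply decide_false in hd.
          destruct (proj1 (hmin x hx)); tauto.
        + now apply decide_true. }
    rewrite wsum_app in h1, h2.
    pose proof (wsum_filter inD L). pose proof (wsum_filter inC L2). lra.
Qed.

(** Each [A n] gets a cover within [eta / 2 ^ (n + 1)] of optimal, and the minimal nodes of all
    these covers together cover the union. Subadditivity as in [union_content] prevents the weights
    from adding up: only the errors do. *)
Lemma content_union (A : nat -> cantor -> Prop) r eta :
  (forall n z, A n z -> A (S n) z) -> (forall n, content_le (A n) r) -> 0 < eta ->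
  content_le (fun z => exists n, A n z) (r + eta).
Proof.
  intros hinc hr heta.
  destruct (choice_fun _ (fun n => content_inf (A n) r (hr n))) as [mu hmu].
  assert (hmu1 : forall n x, content_le (A n) x -> mu n <= x) by (intros n; apply hmu).
  assert (hpow : forall n, 0 < (/2) ^ n) by (intros n; apply pow_lt; lra).
  assert (hC : forall n, content_le (A n) (mu n + eta * (/2) ^ S n)).
  { intros n. apply hmu. apply Rmult_lt_0_compat; [assumption|apply hpow]. }
  destruct (choice_fun _ hC) as [C hC']. clear hC.
  set (U := fun n x => exists m, (m <= n)%nat /\ C m x).
  assert (hA : forall n m z, (m <= n)%nat -> A m z -> A n z).
  { intros n m z hm. induction hm; auto. }
  assert (key : forall n L, NoDup L -> (forall x, In x L -> minimal (U n) x) ->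
     wsum L <= mu n + eta * (1 - (/2) ^ S n)).
  { induction n as [|n IH]; intros L hL hmin.
    - replace (1 - (/2) ^ 1) with ((/2) ^ 1) by lra.
      apply (proj2 (hC' 0%nat)); [assumption|]. intros x hx.
      destruct (hmin x hx) as [[m [hm h]] _]. now replace 0%nat with m by lia.
    - assert (h : wsum L + mu n <= (mu n + eta * (1 - (/2) ^ S n)) +
                     (mu (S n) + eta * (/2) ^ S (S n))).
      2:{ enough (eta * (1 - (/2) ^ S n) + eta * (/2) ^ S (S n) = eta * (1 - (/2) ^ S (S n)))
            by lra. cbn [pow]. lra. }
      (* Both families cover [A n], so its content [mu n] cancels and the bound moves from [mu n] to
         [mu (S n)] plus one new error. *)
      apply (union_content (A n) (minimal (U n)) (C (S n))); try easy.
      + apply hmu1.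
      + intros z hz. destruct (proj1 (hC' n) z hz) as [x [hx hz']].
        apply (minimal_covers (U n) z x); [|assumption]. now exists n.
      + intros z hz. apply (hC' (S n)). now apply hinc.
      + apply (hC' (S n)).
      + intros x hx. destruct (hmin x hx) as [[m [hm hc]] hx']. split.
        * destruct (Nat.eq_dec m (S n)) as [->|]; [now right|]. left. split.
          -- exists m. split; [lia|assumption].
          -- intros y [k [hk hy]]. apply hx'. exists k. split; [lia|assumption].
        * intros y [[[k [hk hy]] _]|hy]; apply hx'.
          -- exists k. split; [lia|assumption].
          -- now exists (S n). }
  exists (minimal (fun x => exists m, C m x)). split.
  - intros z [n hz]. destruct (proj1 (hC' n) z hz) as [x [hx hz']].
    apply (minimal_covers _ z x); [|assumption]. now exists n.
  - intros L hL hmin.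
    (* A finite list meets only finitely many of the covers, so the bound for a finite stage
       applies. *)
    assert (hb : exists n, forall x, In x L -> U n x).
    { clear hL. induction L as [|x L IH]; [exists 0%nat; easy|].
      destruct IH as [n hn]; [intros y hy; apply hmin; now right|].
      destruct (hmin x (or_introl eq_refl)) as [[m hm] _].
      exists (n + m)%nat. intros y [<-|hy].
      - exists m. split; [lia|assumption].
      - destruct (hn y hy) as [k [hk hk']]. exists k. split; [lia|assumption]. }
    destruct hb as [n hn].
    assert (h : wsum L <= mu n + eta * (1 - (/2) ^ S n)).
    { apply key; [assumption|]. intros x hx. split; [now apply hn|].
      intros y [m [_ hy]]. apply (hmin x hx). now exists m. }
    pose proof (hmu1 n r (hr n)). pose proof (hpow (S n)).
    pose proof (Rmult_lt_0_compat eta ((/2) ^ S n) heta (hpow (S n))). lra.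
Qed.

(** The first hypothesis says that [F] is closed. Fixing the bounds [g 0], [g 1], ... in turn keeps
    the content above [eps], as the sets increase with the bound. Compactness of the functions below
    [g] then shows that a cover of the limit set already covers a finite stage. *)
Lemma bounded_witnesses (F : cantor -> (nat -> nat) -> Prop) eps r :
  (forall z f, ~ F z f -> exists u, forall z' f',
     (forall i, (i < u)%nat -> z' i = z i) -> agree u f f' -> ~ F z' f') ->
  eps < r -> ~ content_le (fun z => exists f, F z f) r ->
  exists g, ~ content_le (fun z => exists f, (forall i, (f i <= g i)%nat) /\ F z f) eps.
Proof.
  intros hF her hr.
  set (B := fun g k z => exists f, (forall i, (i < k)%nat -> (f i <= g i)%nat) /\ F z f).
  destruct (choose_sequence
    (fun g k => exists r, eps < r /\ ~ content_le (B g k) r) (fun _ => 0%nat)) as [g hg].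
  - intros g g' u h [x [h1 h2]]. exists x. split; [assumption|]. intros h3. apply h2.
    eapply content_le_mono; [|apply Rle_refl|exact h3]. intros z [f [hf hz]].
    exists f. split; [|assumption]. intros i hi. rewrite h by assumption. now apply hf.
  - exists r. split; [assumption|]. intros h. apply hr.
    eapply content_le_mono; [|apply Rle_refl|exact h]. intros z [f hf].
    exists f. split; [lia|assumption].
  - intros g k [x [hx hn]]. apply NNPP. intros hno. apply hn.
    (* Half of the slack above [eps] is given up at each coordinate, so every stage stays strictly
       above. *)
    replace x with ((x + eps) / 2 + (x - eps) / 2) by lra.
    eapply content_le_mono; [|apply Rle_refl|apply (content_union (fun v => B (upd g k v) (S k)))].
    + intros z [f [hf hz]]. exists (f k), f. split; [|assumption]. intros i hi.
      destruct (Nat.eq_dec i k) as [->|]; [rewrite upd_eq; lia|].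
      rewrite upd_lt by lia. apply hf. lia.
    + intros v z [f [hf hz]]. exists f. split; [|assumption]. intros i hi.
      specialize (hf i hi). destruct (Nat.eq_dec i k) as [->|].
      * rewrite upd_eq in *. lia.
      * rewrite upd_lt in * by lia. lia.
    + intros v. apply NNPP. intros hv. apply hno. exists v, ((x + eps) / 2).
      split; [lra|assumption].
    + lra.
  - exists g. intros [C [hc1 hc2]].
    enough (h : exists k, forall z, B g k z -> exists n, C n /\ within z n).
    { destruct h as [k hk]. destruct (hg k) as [x [hx hn]]. apply hn.
      exists C. split; [assumption|]. intros L h1 h2. specialize (hc2 L h1 h2). lra. }
    apply NNPP. intros hn.
    assert (hk : forall k, exists zf : cantor * (nat -> nat),
      (forall i, (i < k)%nat -> (snd zf i <= g i)%nat) /\ F (fst zf) (snd zf) /\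
      forall n, C n -> ~ within (fst zf) n).
    { intros k. apply NNPP. intros hn2. apply hn. exists k. intros z [f [hf hz]].
      apply NNPP. intros hn3. apply hn2. exists (z, f). repeat split; try assumption.
      intros n h1 h2. apply hn3. now exists n. }
    destruct (choice_fun _ hk) as [zf hzf].
    (* The real and its witness converge together as one joined sequence. The [k]-th witness is
       bounded on its first [k] coordinates only, which is all that [konig] asks. *)
    destruct (konig (fun k => joinN (bseq (fst (zf k))) (snd (zf k))) (joinN (fun _ => 1%nat) g))
      as [h hh].
    { intros k i hi. unfold joinN. destruct (Nat.even i); [apply bseq_le1|].
      apply (hzf k). pose proof (Nat.div2_decr i i). lia. }
    set (z := fun i => Nat.eqb (h (2 * i)%nat) 1). set (f := fun i => h (S (2 * i))).
    assert (hlim : forall u k0, exists k, (k0 <= k)%nat /\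
      (forall i, (i < u)%nat -> fst (zf k) i = z i) /\ agree u f (snd (zf k))).
    { intros u k0. destruct (hh (S (2 * u)) k0) as [k [hk0 ha]]. exists k.
      split; [assumption|]. split; intros i hi.
      - unfold z. rewrite <- (ha (2 * i)%nat) by lia. unfold joinN, bseq.
        rewrite Nat.even_even, Nat.div2_double. now destruct (fst (zf k) i).
      - unfold f. rewrite <- (ha (S (2 * i))) by lia. unfold joinN.
        rewrite Nat.div2_succ_double. replace (Nat.even (S (2 * i))) with false; [reflexivity|].
        symmetry. rewrite Nat.even_succ. apply Nat.odd_even. }
    assert (hz : exists f, (forall i, (f i <= g i)%nat) /\ F z f).
    { exists f. split.
      - intros i. destruct (hlim (S i) (S i)) as [k [hk1 [_ hk2]]].
        rewrite <- (hk2 i) by lia. apply (hzf k). lia.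
      - apply NNPP. intros hnF. destruct (hF z f hnF) as [u hu].
        destruct (hlim u 0%nat) as [k [_ [hk1 hk2]]].
        apply (hu _ _ hk1 hk2). apply (hzf k). }
    (* The limit lies in a node of the cover; approximations that share enough bits lie in it too,
       although they were chosen outside all nodes. *)
    destruct (hc1 z hz) as [n [hn1 hn2]].
    destruct (hlim (fst n) 0%nat) as [k [_ [hk1 _]]].
    apply (proj2 (proj2 (hzf k)) n hn1). unfold within in *. rewrite <- hn2.
    now apply binval_bseq.
Qed.

End Content.

(** * Powers of one half, distances and diameters *)

Lemma half_pow_pos n : 0 < (/2) ^ n.
Proof. apply pow_lt. lra. Qed.

Lemma half_pow_le m n : (m <= n)%nat -> (/2) ^ n <= (/2) ^ m.
Proof.
  intros h. replace n with (m + (n - m))%nat by lia. rewrite pow_add.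
  rewrite <- (Rmult_1_r ((/2) ^ m)) at 2. apply Rmult_le_compat_l.
  - apply Rlt_le, half_pow_pos.
  - rewrite <- (pow1 (n - m)). apply pow_incr. lra.
Qed.

Lemma half_pow_small eta : 0 < eta -> exists n, (/2) ^ n <= eta.
Proof.
  intros h. destruct (pow_lt_1_zero (/2)) with (y := eta) as [n hn]; [|assumption|exists n].
  - rewrite Rabs_right; lra.
  - apply Rlt_le. rewrite <- (Rabs_right ((/2) ^ n)); [apply hn; lia|].
    apply Rle_ge, Rlt_le, half_pow_pos.
Qed.

Lemma half_pow_2 n : (/2) ^ n * INR (2 ^ n) = 1.
Proof. rewrite pow_INR, <- Rpow_mult_distr. cbn [INR]. replace (/2 * (1 + 1)) with 1 by lra. apply pow1. Qed.

Lemma least_nat (P : nat -> Prop) :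
  (exists n, P n) -> exists n, P n /\ forall m, (m < n)%nat -> ~ P m.
Proof.
  intros h. destruct (dec_inh_nat_subset_has_unique_least_element P) as [n [[h1 h2] _]].
  - intros n. apply classic.
  - assumption.
  - exists n. split; [assumption|]. intros m hm hp. specialize (h2 m hp). lia.
Qed.

Lemma first_difference (x y : cantor) :
  (forall m, x m = y m) \/ exists n, (forall m, (m < n)%nat -> x m = y m) /\ x n <> y n.
Proof.
  destruct (classic (exists n, x n <> y n)) as [h|h].
  - right. destruct (least_nat _ h) as [n [h1 h2]]. exists n. split; [|assumption].
    intros m hm. apply NNPP. now apply h2.
  - left. intros m. apply NNPP. intros hm. apply h. now exists m.
Qed.

Lemma cdist_spec x y :
  ((forall m, x m = y m) /\ cdist x y = 0) \/
  (exists n, (forall m, (m < n)%nat -> x m = y m) /\ x n <> y n /\ cdist x y = (/2) ^ n).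
Proof.
  unfold cdist. apply epsilon_spec. destruct (first_difference x y) as [h|[n [h1 h2]]].
  - exists 0. now left.
  - exists ((/2) ^ n). right. now exists n.
Qed.

Lemma cdist_le x y l : (forall m, (m < l)%nat -> x m = y m) -> cdist x y <= (/2) ^ l.
Proof.
  intros h. destruct (cdist_spec x y) as [[_ ->]|[n [_ [h2 ->]]]].
  - apply Rlt_le, half_pow_pos.
  - apply half_pow_le. destruct (Nat.le_gt_cases l n); [assumption|]. now destruct h2; apply h.
Qed.

Lemma cdist_first x y n :
  (forall m, (m < n)%nat -> x m = y m) -> x n <> y n -> cdist x y = (/2) ^ n.
Proof.
  intros h hn. destruct (cdist_spec x y) as [[h1 _]|[m [h1 [h2 ->]]]]; [now destruct hn|].
  destruct (lt_eq_lt_dec m n) as [[hlt| ->]|hlt]; [|reflexivity|].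
  - now destruct h2; apply h.
  - now destruct hn; apply h1.
Qed.

Lemma diam_spec A :
  ((forall a, ~ A a) /\ diam A = 0) \/
  is_lub (fun t => exists a b, A a /\ A b /\ t = cdist a b) (diam A).
Proof.
  unfold diam. apply (epsilon_spec (inhabits 0) (fun r => ((forall a, ~ A a) /\ r = 0) \/
    is_lub (fun t => exists a b, A a /\ A b /\ t = cdist a b) r)).
  destruct (classic (exists a, A a)) as [[a ha]|hn].
  - destruct (completeness (fun t => exists a b, A a /\ A b /\ t = cdist a b)) as [m hm].
    + exists 1. intros t [x [y [_ [_ ->]]]]. now apply (cdist_le x y 0).
    + now exists (cdist a a), a, a.
    + exists m. now right.
  - exists 0. left. split; [|reflexivity]. intros a ha. apply hn. now exists a.
Qed.

Lemma diam_le (A : cantor -> Prop) l :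
  (forall x y, A x -> A y -> forall m, (m < l)%nat -> x m = y m) -> diam A <= (/2) ^ l.
Proof.
  intros h. destruct (diam_spec A) as [[_ ->]|[_ hl]]; [apply Rlt_le, half_pow_pos|].
  apply hl. intros t [x [y [hx [hy ->]]]]. apply cdist_le. now apply h.
Qed.

Lemma diam_ge (A : cantor -> Prop) x y : A x -> A y -> cdist x y <= diam A.
Proof.
  intros hx hy. destruct (diam_spec A) as [[h _]|[hl _]]; [now destruct (h x)|].
  apply hl. now exists x, y.
Qed.

(** * Hausdorff measure versus content with rounded weights *)

Section Dimension.
Variables (s : R) (p : nat -> nat).
Hypothesis s_pos : 0 < s.
Hypothesis p_le : forall l, INR (p l) <= s * INR l.
Hypothesis p_gt : forall l, s * INR l < INR (p l) + 1.

(** With [p l] the integer part of [s * l], this lies between $2^{-sl}$ and twice that, where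
    $2^{-l}$ is the diameter of a cylinder of length [l]. Being a power of one half, it becomes an
    integer after scaling by [2 ^ p N] for [N] at least [l]. *)
Definition weight (l : nat) : R := (/2) ^ p l.

Lemma weight_pos l : 0 < weight l.
Proof. apply half_pow_pos. Qed.

Lemma weight_nonneg l : 0 <= weight l.
Proof. apply Rlt_le, weight_pos. Qed.

Lemma p_mono l m : (l <= m)%nat -> (p l <= p m)%nat.
Proof.
  intros h. apply Nat.lt_succ_r, INR_lt. rewrite S_INR.
  apply le_INR in h. specialize (p_le l). specialize (p_gt m). nra.
Qed.

Lemma weight_mono l m : (l <= m)%nat -> weight m <= weight l.
Proof. intros h. now apply half_pow_le, p_mono. Qed.

Lemma weight_small eta : 0 < eta -> exists l, weight l <= eta.
Proof.
  intros h. destruct (half_pow_small eta h) as [n hn].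
  destruct (INR_archimed s (INR n + 1) s_pos) as [l hl].
  exists l. apply Rle_trans with (2 := hn). apply half_pow_le.
  apply Nat.lt_le_incl, INR_lt. specialize (p_gt l). lra.
Qed.

Lemma Rpower_half n : Rpower ((/2) ^ n) s = exp (- (s * INR n) * ln 2).
Proof.
  unfold Rpower. f_equal. rewrite ln_pow, ln_Rinv by lra. ring.
Qed.

Lemma half_pow_exp n : (/2) ^ n = exp (- INR n * ln 2).
Proof.
  rewrite <- (exp_ln ((/2) ^ n)) by apply half_pow_pos. f_equal.
  rewrite ln_pow, ln_Rinv by lra. ring.
Qed.

Lemma ln2_pos : 0 < ln 2.
Proof. rewrite <- ln_1. apply ln_increasing; lra. Qed.

Lemma exp_le x y : x <= y -> exp x <= exp y.
Proof. intros [h| ->]; [apply Rlt_le, exp_increasing, h|apply Rle_refl]. Qed.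

Lemma rpow0_nonneg r : 0 <= rpow0 r s.
Proof.
  unfold rpow0. destruct (Rle_dec r 0); [apply Rle_refl|]. apply Rlt_le, exp_pos.
Qed.

Lemma rpow0_le_weight r l : r <= (/2) ^ l -> rpow0 r s <= weight l.
Proof.
  intros h. unfold rpow0. destruct (Rle_dec r 0); [apply weight_nonneg|].
  apply Rle_trans with (Rpower ((/2) ^ l) s).
  - apply Rle_Rpower_l; lra.
  - unfold weight. rewrite Rpower_half, half_pow_exp. apply exp_le.
    specialize (p_le l). pose proof ln2_pos. nra.
Qed.

Lemma weight_le_rpow0 r l : (/2) ^ l <= r -> weight l <= 2 * rpow0 r s.
Proof.
  intros h. pose proof (half_pow_pos l). unfold rpow0. destruct (Rle_dec r 0); [lra|].
  apply Rle_trans with (2 * Rpower ((/2) ^ l) s).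
  - unfold weight. rewrite Rpower_half, half_pow_exp.
    rewrite <- (exp_ln 2) at 2 by lra. rewrite <- exp_plus. apply exp_le.
    specialize (p_gt l). pose proof ln2_pos. nra.
  - apply Rmult_le_compat_l; [lra|]. apply Rle_Rpower_l; lra.
Qed.

(** A cover cheaper than [weight n0] cannot contain a node shorter than [n0], so it is automatically
    fine enough for [delta]. Its total then bounds the sum of powers of diameters, against the
    choice of [eps]. *)
Lemma Hs_pos_content E : Hs_pos s E -> exists r, 0 < r /\ ~ content_le weight E r.
Proof.
  intros [delta [eps [hdelta [heps hU]]]].
  destruct (half_pow_small delta hdelta) as [n0 hn0].
  pose proof (weight_pos n0).
  exists (Rmin eps (weight n0) / 2).
  pose proof (Rmin_l eps (weight n0)). pose proof (Rmin_r eps (weight n0)).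
  assert (0 < Rmin eps (weight n0)) by now apply Rmin_glb_lt.
  split; [lra|]. intros [C [hC1 hC2]].
  (* All numbers serve as indices: those outside [C] give the empty set, which contributes zero. *)
  set (U := fun i z => C (of_nat i) /\ within z (of_nat i)).
  assert (hlong : forall n, C n -> (n0 <= fst n)%nat).
  { intros n hn. destruct (Nat.le_gt_cases n0 (fst n)) as [|hlt]; [assumption|]. exfalso.
    assert (h : wsum weight [n] <= Rmin eps (weight n0) / 2).
    { apply hC2; [repeat constructor; easy|]. now intros m [<-|[]]. }
    cbn in h. pose proof (weight_mono (fst n) n0). specialize (H3 ltac:(lia)). lra. }
  assert (hdiam : forall i, diam (U i) <= (/2) ^ fst (of_nat i)).
  { intros i. apply diam_le. intros x y [_ hx] [_ hy]. apply binval_bseq.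
    unfold within in *. congruence. }
  destruct (hU U) as [N hN].
  - intros z hz. destruct (hC1 z hz) as [n [h1 h2]]. exists (to_nat n).
    unfold U. now rewrite cancel_of_to.
  - intros i. destruct (classic (C (of_nat i))) as [hc|hc].
    + apply Rle_trans with (1 := hdiam i). apply Rle_trans with (2 := hn0).
      now apply half_pow_le, hlong.
    + apply Rle_trans with (2 := hn0). apply diam_le. now intros x y [].
  - set (L := fun N => filter (fun n => decide (C n)) (map of_nat (seq 0 N))).
    assert (hL : wsum weight (L (S N)) <= Rmin eps (weight n0) / 2).
    { apply hC2.
      - apply NoDup_filter, NoDup_map_NoDup_ForallPairs; [|apply seq_NoDup].
        intros i j _ _ h. apply (f_equal to_nat) in h. now rewrite !cancel_to_of in h.
      - intros n hn. apply filter_In in hn. now apply decide_true. }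
    assert (hs : forall f, (forall i, C (of_nat i) -> f i <= weight (fst (of_nat i))) ->
       (forall i, ~ C (of_nat i) -> f i <= 0) -> sum_f_R0 f N <= wsum weight (L (S N))).
    { intros f hf1 hf2.
      assert (hst : forall i, f i <= wsum weight (filter (fun n => decide (C n)) [of_nat i])).
      { intros i. cbn [filter]. destruct (decide (C (of_nat i))) eqn:hd.
        - apply (proj1 (decide_true _)) in hd. specialize (hf1 i hd). cbn. lra.
        - apply hf2. apply decide_false. now rewrite hd. }
      assert (hLS : forall N, wsum weight (L (S N)) =
        wsum weight (L N) + wsum weight (filter (fun n => decide (C n)) [of_nat N])).
      { intros M. unfold L. rewrite seq_S, map_app, filter_app, wsum_app. reflexivity. }
      clear - hst hLS. induction N as [|M IH].
      - cbn [sum_f_R0]. rewrite hLS. specialize (hst 0%nat). cbn [L seq map filter] in *. cbn in *. lra.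
      - cbn [sum_f_R0]. rewrite hLS. specialize (hst (S M)). lra. }
    specialize (hs (fun i => rpow0 (diam (U i)) s)).
    assert (sum_f_R0 (fun i => rpow0 (diam (U i)) s) N <= wsum weight (L (S N))).
    { apply hs; intros i hc.
      - apply rpow0_le_weight, hdiam.
      - unfold rpow0. destruct (Rle_dec (diam (U i)) 0) as [|h]; [apply Rle_refl|].
        exfalso. apply h. destruct (diam_spec (U i)) as [[_ ->]|[_ hl]]; [apply Rle_refl|].
        apply hl. now intros t [x [y [[] _]]]. }
    lra.
Qed.

(** The hull branches at the first level [k] where two members of [U] differ, so its diameter is
    that of [U]; the factor 2 is the rounding of the weight. A set with at most one point has
    diameter zero and needs a long cylinder of weight at most [eta]. *)
Lemma cylinder_hull (U : cantor -> Prop) eta :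
  0 < eta -> exists n : node, (forall z, U z -> within z n) /\
                              weight (fst n) <= 2 * rpow0 (diam U) s + eta.
Proof.
  intros heta.
  destruct (classic (exists k x y, U x /\ U y /\ x k <> y k)) as [h|h].
  - destruct (least_nat _ h) as [k [[x [y [hx [hy hk]]]] hmin]].
    assert (hag : forall z z', U z -> U z' -> forall m, (m < k)%nat -> z m = z' m).
    { intros z z' hz hz' m hm. apply NNPP. intros hne. apply (hmin m hm). now exists z, z'. }
    exists (k, binval (bseq x) k). split.
    + intros z hz. unfold within. cbn. apply binval_bseq. now apply hag.
    + cbn. enough (weight k <= 2 * rpow0 (diam U) s) by lra. apply weight_le_rpow0.
      rewrite <- (cdist_first x y k); [now apply diam_ge| |assumption]. now apply hag.
  - destruct (weight_small eta heta) as [l hl].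
    pose proof (rpow0_nonneg (diam U)).
    destruct (classic (exists x, U x)) as [[x hx]|hn].
    + exists (l, binval (bseq x) l). cbn. split; [|lra]. intros z hz. unfold within. cbn.
      apply binval_bseq. intros k _. apply NNPP. intros hne. apply h. now exists k, z, x.
    + exists (l, 0%nat). cbn. split; [|lra]. intros z hz. destruct hn. now exists z.
Qed.

(** * A lower bound for measure from certified costs *)

Section MassDistribution.
Variables (X : nat -> nat -> nat) (c : nat -> nat -> nat -> nat) (a : nat).

Definition tree_class (z : cantor) : Prop := forall l, X l (binval (bseq z) l) <> 0%nat.

(** Measured in units of [weight N], [c N l j] is to be a lower bound for covering the part of the
    tree through [(l, j)] up to height [N]. The four conditions: a node costs at most its own
    weight, at most the cost of its children, nothing off the tree, and the root costs at least
    $2^{-a}$. *)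
Hypothesis c_bound : forall N l j, (c N l j * 2 ^ p l <= 2 ^ p N)%nat.
Hypothesis c_split : forall N l j, (l < N)%nat ->
  (c N l j <= c N (S l) j + c N (S l) (j + 2 ^ l))%nat.
Hypothesis c_tree : forall N l j, X l j = 0%nat -> c N l j = 0%nat.
Hypothesis c_root : forall N, (2 ^ p N <= 2 ^ a * c N 0 0)%nat.

Lemma cost_le_weight N l j : INR (c N l j) * weight N <= weight l.
Proof.
  pose proof (le_INR _ _ (c_bound N l j)) as h. rewrite mult_INR in h.
  pose proof (half_pow_2 (p N)). pose proof (half_pow_2 (p l)).
  pose proof (weight_pos N). pose proof (weight_pos l). unfold weight in *.
  apply Rmult_le_compat_l with (r := (/2) ^ p N * (/2) ^ p l) in h; [|nra].
  nra.
Qed.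

(** Induction on the remaining height [d]. A cover of a node either contains a node at least as
    short, which pays for everything, or splits into covers of the two children, to which [c_split]
    applies. *)
Lemma cost_le_cover N (L : list node) : forall d l z, (l + d = N)%nat ->
  (forall z', binval (bseq z') l = binval (bseq z) l ->
     (forall m, (l <= m <= N)%nat -> X m (binval (bseq z') m) <> 0%nat) ->
     exists n, In n L /\ (fst n <= N)%nat /\ within z' n) ->
  INR (c N l (binval (bseq z) l)) * weight N <= wsum weight L.
Proof.
  intros d. revert L. induction d as [|d IH]; intros L l z hl hcov.
  all: destruct (Nat.eq_dec (X l (binval (bseq z) l)) 0) as [h0|h0];
    [rewrite c_tree by assumption; cbn [INR]; rewrite Rmult_0_l;
     apply wsum_nonneg, weight_nonneg|].
  all: destruct (classic (exists n, In n L /\ (fst n <= l)%nat)) as [[n [h1 h2]]|hlong];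
    [apply Rle_trans with (1 := cost_le_weight N l _); apply Rle_trans with (weight (fst n));
      [now apply weight_mono|now apply wsum_in; [apply weight_nonneg|]]|].
  - exfalso. destruct (hcov z eq_refl) as [n [h1 [h2 _]]].
    + intros m hm. now replace m with l by lia.
    + apply hlong. exists n. split; [assumption|lia].
  (* All nodes of [L] are now longer than [l], so bit [l] is determined on each nonempty cylinder
     and the list divides between the two children. *)
  - set (sel := fun n : node => decide (exists z', within z' n /\ z' l = true)).
    rewrite (wsum_filter weight sel).
    assert (hb : forall b : bool, exists z', (forall m, (m < l)%nat -> z' m = z m) /\ z' l = b).
    { intros b. exists (fun m => if Nat.eqb m l then b else z m). split.
      - intros m hm. now destruct (Nat.eqb_spec m l); [lia|].
      - now rewrite Nat.eqb_refl. }
    assert (hstep : forall b L', (forall z' n, In n L -> within z' n -> z' l = b -> In n L') ->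
      exists z', z' l = b /\ binval (bseq z') l = binval (bseq z) l /\
      INR (c N (S l) (binval (bseq z') (S l))) * weight N <= wsum weight L').
    { intros b L' hL'. destruct (hb b) as [zb [hz1 hz2]]. exists zb.
      split; [assumption|]. split; [now apply binval_bseq|]. apply IH; [lia|].
      intros z' hz' hX. pose proof (proj1 (binval_bseq z' zb (S l)) hz') as hag.
      destruct (hcov z') as [n [h1 [h2 h3]]].
      - apply binval_bseq. intros m hm. rewrite hag by lia. now apply hz1.
      - intros m hm. destruct (Nat.eq_dec m l) as [->|]; [|apply hX; lia].
        replace (binval (bseq z') l) with (binval (bseq z) l); [assumption|].
        apply binval_bseq. intros m hm'. rewrite hag by lia. symmetry. now apply hz1.
      - exists n. repeat split; try assumption. apply (hL' z'); try assumption.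
        rewrite hag by lia. assumption. }
    destruct (hstep true (filter sel L)) as [z1 [h1 [h2 h3]]].
    { intros z' n hn hw hz'. apply filter_In. split; [assumption|]. apply decide_true.
      now exists z'. }
    destruct (hstep false (filter (fun n => negb (sel n)) L)) as [z0 [h4 [h5 h6]]].
    { intros z' n hn hw hz'. apply filter_In. split; [assumption|]. apply decide_false.
      intros [z'' [hw' hz'']].
      assert (hlt : (l < fst n)%nat).
      { destruct (Nat.le_gt_cases (fst n) l); [|assumption]. destruct hlong. now exists n. }
      unfold within in hw, hw'. rewrite <- hw' in hw.
      pose proof (proj1 (binval_bseq z' z'' (fst n)) hw l hlt). congruence. }
    rewrite binval_S in h3, h6. rewrite h2 in h3. rewrite h5 in h6.
    unfold bseq in h3 at 1. unfold bseq in h6 at 1. rewrite h1 in h3. rewrite h4 in h6.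
    rewrite Nat.mul_1_l, Nat.add_comm in h3. rewrite Nat.mul_0_l, Nat.add_0_l in h6.
    pose proof (le_INR _ _ (c_split N l (binval (bseq z) l) ltac:(lia))) as h.
    rewrite plus_INR in h. pose proof (weight_pos N). nra.
Qed.

Lemma tree_class_Hs_pos : Hs_pos s tree_class.
Proof.
  pose proof (half_pow_pos a).
  (* The hulls are allowed errors [2^-a / 4 * 2^-i], below [2^-a / 2] in total. Since the hulls
     weigh at least [2^-a] and at most twice the sum of powers plus these errors, that sum is at
     least [2^-a / 4]. *)
  exists 1, ((/2) ^ a / 4). split; [lra|]. split; [lra|]. intros U hU _.
  destruct (choice_fun _ (fun i => cylinder_hull (U i) ((/2) ^ a / 4 * (/2) ^ i)
     ltac:(apply Rmult_lt_0_compat; [lra|apply half_pow_pos]))) as [v hv].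
  (* Compactness: reals that follow the tree to height [N] and escape the first [N] hulls would have
     a limit on the tree outside every hull. *)
  assert (hN : exists N, forall z, (forall m, (m <= N)%nat -> X m (binval (bseq z) m) <> 0%nat) ->
     exists i, (i <= N)%nat /\ (fst (v i) <= N)%nat /\ within z (v i)).
  { apply NNPP. intros hn.
    assert (hz : forall N, exists z, (forall m, (m <= N)%nat -> X m (binval (bseq z) m) <> 0%nat) /\
       forall i, (i <= N)%nat -> (fst (v i) <= N)%nat -> ~ within z (v i)).
    { intros N. apply NNPP. intros hn'. apply hn. exists N. intros z hz.
      apply NNPP. intros hn2. apply hn'. exists z. split; [assumption|].
      intros i h1 h2 h3. apply hn2. now exists i. }
    destruct (choice_fun _ hz) as [zs hzs].
    destruct (konig (fun N => bseq (zs N)) (fun _ => 1%nat)) as [h hh].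
    { intros. apply bseq_le1. }
    set (z := fun i => Nat.eqb (h i) 1).
    assert (hlim : forall u k0, exists k, (k0 <= k)%nat /\
      (forall i, (i < u)%nat -> zs k i = z i)).
    { intros u k0. destruct (hh u k0) as [k [hk ha]]. exists k. split; [assumption|].
      intros i hi. unfold z. rewrite <- (ha i) by assumption. unfold bseq.
      now destruct (zs k i). }
    assert (hz' : tree_class z).
    { intros m. destruct (hlim m m) as [k [hk ha]].
      rewrite (proj2 (binval_bseq z (zs k) m)) by (intros i hi; symmetry; now apply ha).
      now apply (hzs k). }
    destruct (hU z hz') as [i hi]. apply (hv i) in hi.
    destruct (hlim (fst (v i)) (i + fst (v i))%nat) as [k [hk ha]].
    apply (proj2 (hzs k) i); [lia|lia|]. unfold within in *. rewrite <- hi.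
    now apply binval_bseq. }
  destruct hN as [N hN]. exists N.
  assert (h1 : INR (c N 0 0) * weight N <= wsum weight (map v (seq 0 (S N)))).
  { apply (cost_le_cover N _ N 0%nat (fun _ => false)); [reflexivity|].
    intros z' _ hz'. destruct (hN z') as [i [hi1 [hi2 hi3]]]; [intros; apply hz'; lia|].
    exists (v i). split; [|easy]. apply in_map, in_seq. lia. }
  assert (h2 : (/2) ^ a <= INR (c N 0 0) * weight N).
  { pose proof (le_INR _ _ (c_root N)) as h. rewrite mult_INR in h.
    pose proof (half_pow_2 (p N)). pose proof (half_pow_2 a).
    pose proof (weight_pos N). unfold weight in *.
    apply Rmult_le_compat_l with (r := (/2) ^ p N * (/2) ^ a) in h; [|nra]. nra. }
  assert (h3 : forall M, wsum weight (map v (seq 0 (S M))) <=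
     2 * sum_f_R0 (fun i => rpow0 (diam (U i)) s) M + (/2) ^ a / 4 * (2 - (/2) ^ M)).
  { induction M as [|M IH].
    - destruct (hv 0%nat) as [_ h]. cbn in *. lra.
    - rewrite seq_S, map_app, wsum_app. cbn [map sum_f_R0].
      destruct (hv (S M)) as [_ h]. rewrite wsum_cons. cbn [plus pow] in *.
      change (wsum weight nil) with 0. lra. }
  specialize (h3 N). pose proof (half_pow_pos N). nra.
Qed.

End MassDistribution.

(** The certificate is the true optimum, computed downwards from height [N] on the tree of initial
    segments of [A]. An optimum below $2^{-a}$ at the root would be realized by a finite cover of
    [A]. *)
Lemma cost_exists (A : cantor -> Prop) a :
  ~ content_le weight A ((/2) ^ a) ->
  exists c : nat -> nat -> nat -> nat,
    let X := fun l j => if decide (exists z, A z /\ binval (bseq z) l = j) then 1%nat else 0%nat in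
    (forall N l j, (c N l j * 2 ^ p l <= 2 ^ p N)%nat) /\
    (forall N l j, (l < N)%nat -> (c N l j <= c N (S l) j + c N (S l) (j + 2 ^ l))%nat) /\
    (forall N l j, X l j = 0%nat -> c N l j = 0%nat) /\
    (forall N, (2 ^ p N <= 2 ^ a * c N 0 0)%nat).
Proof.
  intros hA.
  set (X := fun l j => if decide (exists z, A z /\ binval (bseq z) l = j) then 1%nat else 0%nat).
  assert (hX1 : forall l j, (X l j <= 1)%nat) by (intros; unfold X; destruct (decide _); lia).
  (* Here [d] is the distance to height [N]. On the tree the cheaper choice is taken between the
     node itself, worth [2 ^ (p N - p (N - d))] units, and covering both children. *)
  set (m := fun N => fix m (d j : nat) : nat :=
    match d with
    | 0 => X N j
    | S d' => X (N - d)%nat j * Nat.min (2 ^ (p N - p (N - d)))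
                 (m d' j + m d' (j + 2 ^ (N - d)))
    end%nat).
  (* Zero above height [N] keeps the bound by [2 ^ p N] true for every [l]. *)
  exists (fun N l j => if Nat.leb l N then m N (N - l)%nat j else 0%nat). cbv zeta.
  assert (hpow : forall N l, (l <= N)%nat -> (2 ^ (p N - p l) * 2 ^ p l = 2 ^ p N)%nat).
  { intros N l hl. rewrite <- Nat.pow_add_r. f_equal. pose proof (p_mono l N hl). lia. }
  repeat split.
  - intros N l j. destruct (Nat.leb_spec l N) as [hl|]; [|lia].
    destruct (N - l)%nat as [|d] eqn:hd; cbn [m].
    + replace N with l by lia. specialize (hX1 l j). nia.
    + rewrite <- hd. replace (N - (N - l))%nat with l by lia.
      rewrite <- (hpow N l) by lia. specialize (hX1 l j).
      apply Nat.mul_le_mono_r.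
      apply Nat.le_trans with (1 * 2 ^ (p N - p l))%nat; [|lia].
      apply Nat.mul_le_mono; [assumption|apply Nat.le_min_l].
  - intros N l j hl. destruct (Nat.leb_spec l N); [|lia].
    destruct (Nat.leb_spec (S l) N); [|lia].
    replace (N - l)%nat with (S (N - S l)) by lia. cbn [m].
    replace (N - S (N - S l))%nat with l by lia.
    specialize (hX1 l j). set (q := (m N (N - S l) j + m N (N - S l) (j + 2 ^ l))%nat).
    apply Nat.le_trans with (1 * q)%nat; [|lia].
    apply Nat.mul_le_mono; [assumption|apply Nat.le_min_r].
  - intros N l j h0. destruct (Nat.leb_spec l N); [|reflexivity]. fold X in h0.
    change (X l j = 0%nat) in h0.
    destruct (N - l)%nat as [|d] eqn:hd; cbn [m].
    + now replace N with l by lia.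
    + rewrite <- hd. replace (N - (N - l))%nat with l by lia. now rewrite h0.
  - intros N. cbn [Nat.leb]. rewrite Nat.sub_0_r.
    (* Unwinding the minima produces an actual cover whose weight is at most the computed cost. *)
    assert (hcov : forall d j, (d <= N)%nat -> exists L,
      (forall z, A z -> binval (bseq z) (N - d) = j -> exists n, In n L /\ within z n) /\
      wsum weight L <= INR (m N d j) * weight N).
    { assert (hnil : forall d j, ~ (exists z, A z /\ binval (bseq z) (N - d) = j) ->
        exists L : list node, (forall z, A z -> binval (bseq z) (N - d) = j ->
          exists n, In n L /\ within z n) /\ wsum weight L <= INR (m N d j) * weight N).
      { intros d j he. exists nil. split.
        - intros z hz hj. destruct he. now exists z.
        - apply Rmult_le_pos; [apply pos_INR|apply weight_nonneg]. }
      assert (hXe : forall l j, (exists z, A z /\ binval (bseq z) l = j) -> X l j = 1%nat).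
      { intros l j he. unfold X. now rewrite (proj2 (decide_true _) he). }
      induction d as [|d IH]; intros j hd; cbn [m].
      - destruct (classic (exists z, A z /\ binval (bseq z) (N - 0) = j)) as [he|he];
          [|now apply hnil].
        apply hXe in he. rewrite Nat.sub_0_r in he.
        exists [(N, j)]. split.
        + intros z hz hj. exists (N, j). split; [now left|]. unfold within. cbn.
          now rewrite <- hj, Nat.sub_0_r.
        + rewrite he. cbn. lra.
      - destruct (classic (exists z, A z /\ binval (bseq z) (N - S d) = j)) as [he|he];
          [|now apply (hnil (S d))].
        apply hXe in he. set (l0 := (N - S d)%nat) in *.
        rewrite he, Nat.mul_1_l. apply Nat.min_case_strong; intros _.
        + exists [(l0, j)]. split.
          * intros z hz hj. exists (l0, j). split; [now left|exact hj].
          * assert (hw : INR (2 ^ (p N - p l0)) * weight N = weight l0).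
            { pose proof (f_equal INR (hpow N l0 ltac:(unfold l0; lia))) as h.
              rewrite mult_INR in h. pose proof (half_pow_2 (p N)).
              pose proof (half_pow_2 (p l0)). unfold weight in *.
              rewrite <- h in *.
              transitivity (INR (2 ^ (p N - p l0)) * (/2) ^ p N * ((/2) ^ p l0 * INR (2 ^ p l0))).
              - rewrite H0. ring.
              - transitivity ((/2) ^ p l0 * ((/ 2) ^ p N * (INR (2 ^ (p N - p l0)) * INR (2 ^ p l0)))).
                + ring.
                + rewrite H. ring. }
            rewrite hw. cbn. lra.
        + destruct (IH j ltac:(lia)) as [L0 [h2 h3]].
          destruct (IH (j + 2 ^ l0)%nat ltac:(lia)) as [L1 [h4 h5]].
          exists (L0 ++ L1). rewrite wsum_app, plus_INR. split; [|lra].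
          intros z hz hj. replace (N - d)%nat with (S l0) in h2, h4 by (unfold l0; lia).
          destruct (z l0) eqn:hzl.
          * destruct (h4 z hz) as [n [hn1 hn2]].
            { rewrite binval_S. fold l0 in hj. rewrite hj. unfold bseq. rewrite hzl. lia. }
            exists n. split; [apply in_app_iff; now right|assumption].
          * destruct (h2 z hz) as [n [hn1 hn2]].
            { rewrite binval_S. fold l0 in hj. rewrite hj. unfold bseq. rewrite hzl. lia. }
            exists n. split; [apply in_app_iff; now left|assumption]. }
    destruct (hcov N 0%nat (le_n N)) as [L [hL1 hL2]].
    assert (h : (/2) ^ a <= INR (m N N 0%nat) * weight N).
    { apply Rnot_lt_le. intros hlt. apply hA. exists (fun n => In n L). split.
      - intros z hz. apply hL1; [assumption|]. now rewrite Nat.sub_diag.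
      - intros L' h1 h2. pose proof (wsum_incl weight weight_nonneg L' L h1 h2). lra. }
    apply INR_le. rewrite mult_INR. pose proof (half_pow_2 (p N)). pose proof (half_pow_2 a).
    pose proof (pos_INR (2 ^ a)). pose proof (pos_INR (2 ^ p N)). unfold weight in h.
    apply Rmult_le_compat_l with (r := INR (2 ^ p N) * INR (2 ^ a)) in h; [|nra]. nra.
Qed.

End Dimension.

Lemma comp_hd_iter n k : Comp n (fun _ a => hd 0%nat (Nat.iter k (@tl nat) a)).
Proof.
  apply (comp_ext n (fun _ a => nth k a 0%nat)); [|apply comp_nth].
  intros _ a _. revert a. induction k as [|k IH]; intros a; [now destruct a|].
  rewrite Nat.iter_succ_r, <- IH. destruct a; [now destruct k|reflexivity].
Qed.

Lemma comp_nth_iter n i k : Comp n (fun _ a => nth i (Nat.iter k (@tl nat) a) 0%nat).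
Proof.
  apply (comp_ext n (fun _ a => nth (k + i) a 0%nat)); [|apply comp_nth].
  intros _ a _. revert a. induction k as [|k IH]; intros a; [reflexivity|].
  rewrite Nat.iter_succ_r, <- IH. destruct a; [now destruct (k + i)%nat|reflexivity].
Qed.

Definition gap (m n : nat) : nat := ((m - n) + (n - m))%nat.

Ltac comp_step :=
  lazymatch goal with
  | |- Comp _ (fun _ _ => ?k) => apply comp_const
  | |- Comp _ (fun al a => (@?F al a + @?G al a)%nat) => apply (comp_add _ F G)
  | |- Comp _ (fun al a => (@?F al a * @?G al a)%nat) => apply (comp_mul _ F G)
  | |- Comp _ (fun al a => (@?F al a - @?G al a)%nat) => apply (comp_sub _ F G)
  | |- Comp _ (fun al a => S (@?F al a)) => apply (comp_S _ F)
  | |- Comp _ (fun al a => (2 ^ (@?F al a))%nat) => apply (comp_pow2 _ F)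
  | |- Comp _ (fun al a => to_nat (@?F al a, @?G al a)) => apply (comp_pair _ F G)
  | |- Comp _ (fun al a => gap (@?F al a) (@?G al a)) =>
      apply (comp_add _ (fun al a => F al a - G al a)%nat
        (fun al a => G al a - F al a)%nat)
  | |- Comp _ (fun al a => bsum (fun i => @?F al a i) (@?N al a)) => apply (comp_bsum _ F N)
  | |- Comp _ (fun al a => binval (fun i => @?F al a i) (@?N al a)) =>
      apply (comp_bsum _ (fun al a i => F al a i * 2 ^ i)%nat N)
  | |- Comp _ (fun al a => al (@?F al a)) => apply (comp_oracle _ F)
  | |- Comp ?n (fun _ a => hd 0%nat _) =>
      first [exact (comp_hd_iter n 0) | exact (comp_hd_iter n 1) | exact (comp_hd_iter n 2)
            | exact (comp_hd_iter n 3) | exact (comp_hd_iter n 4)]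
  | |- Comp ?n (fun _ a => nth ?i _ 0%nat) =>
      first [exact (comp_nth_iter n i 0) | exact (comp_nth_iter n i 1)
            | exact (comp_nth_iter n i 2) | exact (comp_nth_iter n i 3)
            | exact (comp_nth_iter n i 4)]
  end.

(** * Trees with certificates as a closed class of functions *)

Section AdmissibleCodes.
Local Open Scope nat_scope.

Lemma gap_eq0 m n : gap m n = 0 <-> m = n.
Proof. unfold gap. lia. Qed.

(* The term [1 - (v * S i - u * l)] is the truth value of [v * S i <= u * l], so this is
   the integer part of [u * l / v]. *)
Definition floor_mul (u v l : nat) : nat := bsum (fun i => 1 - (v * S i - u * l)) (u * l).

Lemma floor_mul_spec u v l : 0 < v -> floor_mul u v l = u * l / v.
Proof.
  intros hv. unfold floor_mul. set (n := u * l).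
  assert (h : forall m, bsum (fun i => 1 - (v * S i - n)) m = Nat.min m (n / v)).
  { induction m as [|m IH]; [reflexivity|]. rewrite bsum_S, IH.
    pose proof (Nat.div_mod_eq n v). pose proof (Nat.mod_upper_bound n v ltac:(lia)).
    destruct (Nat.le_gt_cases (S m) (n / v)); nia. }
  rewrite h. apply Nat.min_r. apply Nat.Div0.div_le_upper_bound. nia.
Qed.

Lemma comp_floor_mul u v : Comp 1 (fun _ a => floor_mul u v (hd 0 a)).
Proof. unfold floor_mul. repeat comp_step. Qed.

Variables (p : nat -> nat) (depth : nat) (e0 : code).
Hypothesis p_comp : Comp 1 (fun _ a => p (hd 0 a)).

(* A single function [h] codes a tree [X] of nodes [(l, j)], a bound [G] on witnesses, for
   every node an oracle [B] joining a path through the node with a witness for it, and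
   costs [c] of covering the part of the tree of height [N] above a node. *)
Definition tree_part (h : nat -> nat) l j := h (to_nat (0, to_nat (l, j))).
Definition bound_part (h : nat -> nat) k := h (to_nat (1, k)).
Definition oracle_part (h : nat -> nat) l j k := h (to_nat (2, to_nat (l, to_nat (j, k)))).
Definition cost_part (h : nat -> nat) N l j := h (to_nat (3, to_nat (N, to_nat (l, j)))).

(** Truncated subtraction expresses inequalities and products express implications, so the sum
    vanishes exactly when every clause holds. The first four terms are the conditions on costs. The
    other four, guarded by the tree, say that the oracle at [(l, j)] has bounded odd entries, starts
    with bits that spell [j], and does not make [e0] halt within [l] steps of search. *)
Definition defect (h : nat -> nat) (N l j k : nat) : nat :=
  (cost_part h N l j * 2 ^ p l - 2 ^ p N) +
  (N - l) * (cost_part h N l j - (cost_part h N (S l) j + cost_part h N (S l) (j + 2 ^ l))) +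
  cost_part h N l j * (1 - tree_part h l j) +
  (2 ^ p N - 2 ^ depth * cost_part h N 0 0) +
  tree_part h l j * (oracle_part h l j (S (2 * k)) - bound_part h k) +
  tree_part h l j * ((l - k) * (oracle_part h l j (2 * k) - 1)) +
  tree_part h l j * gap (binval (fun i => oracle_part h l j (2 * i)) l) j +
  tree_part h l j * run (oracle_part h l j) l e0 nil.

(** The transformation [o] lets the tree code be read from part of a larger witness; the final
    definitions prepend a clock to it. *)
Lemma comp_defect n (o : (nat -> nat) -> nat -> nat) N l j k :
  Comp 1 (fun al a => o al (hd 0 a)) ->
  Comp n N -> Comp n l -> Comp n j -> Comp n k ->
  Comp n (fun al a => defect (o al) (N al a) (l al a) (j al a) (k al a)).
Proof.
  intros ho hN hl hj hk.
  apply (comp_comp n (fun al a => defect (o al) (nth 0 a 0) (nth 1 a 0) (nth 2 a 0) (nth 3 a 0))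
    [N; l; j; k]); [|now repeat constructor].
  cbn [length]. clear N l j k hN hl hj hk.
  unfold defect, cost_part, tree_part, oracle_part, bound_part.
  assert (hr : Comp 4 (fun al a => run (fun k => o al (to_nat (2, to_nat (nth 1 a 0,
     to_nat (nth 2 a 0, k))))) (nth 1 a 0) e0 nil)).
  { apply (comp_run e0 4 (fun al a k => o al (to_nat (2, to_nat (nth 1 a 0,
     to_nat (nth 2 a 0, k))))) (fun _ a => nth 1 a 0) nil); [|apply comp_nth|constructor].
    apply (comp_subst _ o); [exact ho|]. repeat comp_step. }
  repeat first [comp_step | apply (comp_subst _ o); [exact ho|]
               | apply (comp_subst _ (fun _ => p)); [exact p_comp|] | exact hr].
Qed.

Definition admissible (h : nat -> nat) : Prop := forall N l j k, defect h N l j k = 0.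

Lemma comp_id : Comp 1 (fun al a => al (hd 0 a)).
Proof. apply comp_oracle, comp_hd. Qed.

(** Each single [defect] is a total computable functional, hence depends on a finite part of [h]. *)
Lemma admissible_closed h :
  (forall u, exists h', admissible h' /\ agree u h h') -> admissible h.
Proof.
  intros H N l j k.
  destruct (comp_continuous 4 (fun al a => defect al (nth 0 a 0) (nth 1 a 0) (nth 2 a 0)
     (nth 3 a 0)) h [N; l; j; k]) as [u hu]; [|reflexivity|].
  - apply (comp_defect 4 (fun al => al)); [apply comp_id| | | |]; apply comp_nth.
  - destruct (H u) as [h' [h1 h2]]. specialize (hu h' h2). cbn [nth] in hu.
    rewrite <- hu. apply h1.
Qed.

Lemma admissible_iff h : admissible h <->
  (forall N l j, cost_part h N l j * 2 ^ p l <= 2 ^ p N) /\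
  (forall N l j, l < N -> cost_part h N l j <=
      cost_part h N (S l) j + cost_part h N (S l) (j + 2 ^ l)) /\
  (forall N l j, tree_part h l j = 0 -> cost_part h N l j = 0) /\
  (forall N, 2 ^ p N <= 2 ^ depth * cost_part h N 0 0) /\
  (forall l j, tree_part h l j <> 0 ->
    (forall k, oracle_part h l j (S (2 * k)) <= bound_part h k) /\
    (forall k, k < l -> oracle_part h l j (2 * k) <= 1) /\
    binval (fun i => oracle_part h l j (2 * i)) l = j /\
    run (oracle_part h l j) l e0 nil = 0).
Proof.
  assert (hd : forall N l j k, defect h N l j k = 0 <->
    cost_part h N l j * 2 ^ p l <= 2 ^ p N /\
    (N - l = 0 \/ cost_part h N l j <=
       cost_part h N (S l) j + cost_part h N (S l) (j + 2 ^ l)) /\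
    (cost_part h N l j = 0 \/ 1 <= tree_part h l j) /\
    2 ^ p N <= 2 ^ depth * cost_part h N 0 0 /\
    (tree_part h l j = 0 \/ oracle_part h l j (S (2 * k)) <= bound_part h k) /\
    (tree_part h l j = 0 \/ l - k = 0 \/ oracle_part h l j (2 * k) <= 1) /\
    (tree_part h l j = 0 \/ binval (fun i => oracle_part h l j (2 * i)) l = j) /\
    (tree_part h l j = 0 \/ run (oracle_part h l j) l e0 nil = 0)).
  { intros N l j k. unfold defect.
    now rewrite !Nat.eq_add_0, !Nat.eq_mul_0, gap_eq0, !Nat.sub_0_le, !and_assoc. }
  unfold admissible. split.
  - intros H. repeat split.
    + intros N l j. now apply (hd N l j 0).
    + intros N l j hl. destruct (proj1 (hd N l j 0) (H _ _ _ _)) as [_ [[h1|h1] _]];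
        [lia|exact h1].
    + intros N l j h0. destruct (proj1 (hd N l j 0) (H _ _ _ _)) as [_ [_ [[h1|h1] _]]];
        [exact h1|lia].
    + intros N. now apply (hd N 0 0 0).
    + intros k. destruct (proj1 (hd 0 l j k) (H _ _ _ _)) as [_ [_ [_ [_ [h1 _]]]]]. tauto.
    + intros k hk.
      destruct (proj1 (hd 0 l j k) (H _ _ _ _)) as [_ [_ [_ [_ [_ [[h1|[h1|h1]] _]]]]]];
        [tauto|lia|exact h1].
    + destruct (proj1 (hd 0 l j 0) (H _ _ _ _)) as [_ [_ [_ [_ [_ [_ [h1 _]]]]]]]. tauto.
    + destruct (proj1 (hd 0 l j 0) (H _ _ _ _)) as [_ [_ [_ [_ [_ [_ [_ h1]]]]]]]. tauto.
  - intros [h1 [h2 [h3 [h4 h5]]]] N l j k. apply hd.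
    split; [apply h1|]. split.
    { destruct (Nat.le_gt_cases N l); [left; lia|right; now apply h2]. }
    split.
    { destruct (Nat.eq_dec (tree_part h l j) 0); [left; auto|right; lia]. }
    split; [apply h4|].
    destruct (Nat.eq_dec (tree_part h l j) 0) as [h0|h0]; [tauto|].
    destruct (h5 l j h0) as [g1 [g2 [g3 g4]]]. specialize (g1 k).
    destruct (Nat.le_gt_cases l k) as [hk|hk]; [|specialize (g2 k hk)]; repeat split; try tauto.
    right. left. lia.
Qed.

(** Only where the tree part is nonzero matters for the class of paths, and that pattern is already
    a real; bounds and oracles, with arbitrary values, stay outside. *)
Definition tree_real (h : nat -> nat) : cantor := fun n => negb (h (to_nat (0, n)) =? 0).

Lemma bseq_tree_real h n : bseq (tree_real h) n = 1 - (1 - h (to_nat (0, n))).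
Proof.
  unfold bseq, tree_real. destruct (Nat.eqb_spec (h (to_nat (0, n))) 0) as [->|]; cbn [negb]; lia.
Qed.

Lemma joinN_even f g i : joinN f g (2 * i) = f i.
Proof. unfold joinN. now rewrite Nat.even_even, Nat.div2_double. Qed.

Lemma joinN_odd f g i : joinN f g (S (2 * i)) = g i.
Proof. unfold joinN. now rewrite Nat.even_succ, Nat.odd_even, Nat.div2_succ_double. Qed.

Lemma tree_class_Pi01 h : Pi01_rel (tree_real h) (tree_class (tree_part h)).
Proof.
  destruct (comp_search 0 (fun al a => 1 - al (2 * to_nat (nth 0 a 0,
      binval (fun i => al (S (2 * i))) (nth 0 a 0))))) as [e he].
  { repeat comp_step. }
  exists e. intros z. rewrite (he _ nil eq_refl). cbn [nth]. unfold tree_class, tree_part.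
  assert (hb : forall t, binval (fun i => joinN (bseq (tree_real h)) (bseq z) (S (2 * i))) t =
      binval (bseq z) t).
  { intros t. apply binval_ext. intros i _. now rewrite joinN_odd. }
  split.
  - intros H [t ht]. apply ht. rewrite hb, joinN_even, bseq_tree_real. specialize (H t). lia.
  - intros H l h0. apply H. exists l. rewrite hb, joinN_even, bseq_tree_real, h0. cbn. lia.
Qed.

(** The oracles at the initial segments of [z] have bounded entries, so they have a limit point,
    whose odd entries are the witness. A halting computation with it would use finitely many values
    and thus appear already, within the clock, at some node of the path. *)
Lemma tree_class_witness h z :
  admissible h -> tree_class (tree_part h) z ->
  exists f, ~ halts (joinN (bseq z) f) e0 nil.
Proof.
  intros hh hz. apply admissible_iff in hh. destruct hh as [_ [_ [_ [_ hB]]]].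
  pose (b := fun l => oracle_part h l (binval (bseq z) l)).
  assert (hb : forall l, (forall k, b l (S (2 * k)) <= bound_part h k) /\
     (forall k, k < l -> b l (2 * k) = bseq z k) /\ run (b l) l e0 nil = 0).
  { intros l. destruct (hB l _ (hz l)) as [h1 [h2 [h3 h4]]]. repeat split; try assumption.
    intros k hk.
    pose proof (binval_inj _ _ l h2 (fun k _ => bseq_le1 z k) h3 k hk). now symmetry. }
  destruct (konig b (joinN (fun _ => 1) (bound_part h))) as [g hg].
  { intros k i hi. destruct (hb k) as [h1 [h2 _]].
    destruct (Nat.Even_or_Odd i) as [[m ->]|[m ->]].
    - rewrite joinN_even, h2 by lia. apply bseq_le1.
    - rewrite Nat.add_1_r, joinN_odd. apply h1. }
  exists (fun k => g (S (2 * k))). intros [r hr].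
  destruct (eval_run _ _ _ _ hr) as [u hu].
  destruct (hg u (u + u)) as [k [hk ha]].
  specialize (hu k (b k) ltac:(lia)). rewrite (proj2 (proj2 (hb k))) in hu.
  discriminate hu. intros i hi.
  destruct (Nat.Even_or_Odd i) as [[m ->]|[m ->]].
  - rewrite joinN_even. apply (hb k). lia.
  - rewrite Nat.add_1_r, joinN_odd. apply ha. lia.
Qed.

End AdmissibleCodes.

(** The tree consists of the initial segments of the members of [E] with a witness below [g]. Each
    node receives a member through it joined with such a witness, and the costs are the optimal
    ones. *)
Lemma admissible_exists (s : R) (p : nat -> nat) (e0 : code) (E : cantor -> Prop) :
  0 < s -> (forall l, INR (p l) <= s * INR l) -> (forall l, s * INR l < INR (p l) + 1) ->
  (forall z, E z <-> exists f, ~ halts (joinN (bseq z) f) e0 nil) -> Hs_pos s E ->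
  exists depth h, admissible p depth e0 h.
Proof.
  intros hs hp1 hp2 hE hpos.
  destruct (Hs_pos_content s p hs hp1 hp2 E hpos) as [r [hr hc]].
  (* Strictly below [r], to leave the slack that [bounded_witnesses] spends. *)
  destruct (half_pow_small (r / 2)) as [a ha]; [lra|].
  destruct (bounded_witnesses (weight p)
    (fun z f => ~ halts (joinN (bseq z) f) e0 nil) ((/2) ^ a) r) as [g hg].
  (* Divergence is a closed condition, since a halting computation has finite use. *)
  - intros z f hn. apply NNPP in hn. destruct hn as [q hq].
    destruct (eval_run _ _ _ _ hq) as [u hu]. exists u. intros z' f' hz hf hn.
    apply hn. exists q. apply (run_sound _ u), hu; [lia|]. intros i hi.
    unfold joinN. pose proof (Nat.div2_decr i i). destruct (Nat.even i).
    + unfold bseq. rewrite hz by lia. reflexivity.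
    + apply hf. lia.
  - lra.
  - intros h. apply hc. eapply content_le_mono; [| |exact h]; [|lra].
    intros z hz. now apply hE.
  - set (A := fun z => exists f, (forall i, (f i <= g i)%nat) /\
        ~ halts (joinN (bseq z) f) e0 nil) in hg.
    destruct (cost_exists s p hs hp1 hp2 A a hg) as [c hcost]. cbv zeta in hcost.
    set (X := fun l j => if decide (exists z, A z /\ binval (bseq z) l = j)
       then 1%nat else 0%nat) in hcost.
    assert (hB : forall lj : nat * nat, exists b : nat -> nat, X (fst lj) (snd lj) <> 0%nat ->
       exists z f, b = joinN (bseq z) f /\ binval (bseq z) (fst lj) = snd lj /\
         (forall i, (f i <= g i)%nat) /\ ~ halts b e0 nil).
    { intros [l j]. cbn [fst snd]. unfold X.
      destruct (decide (exists z, A z /\ binval (bseq z) l = j)) eqn:hd.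
      - apply (proj1 (decide_true _)) in hd. destruct hd as [z [[f [hf1 hf2]] hj]].
        exists (joinN (bseq z) f). intros _. now exists z, f.
      - exists (fun _ => 0%nat). now intros []. }
    destruct (choice_fun _ hB) as [B hB']. clear hB.
    pose (h := fun m => (let (i, n) := of_nat m in
      match i with
      | 0 => let (l, j) := of_nat n in X l j
      | 1 => g n
      | 2 => let (l, q) := of_nat n in let (j, k) := of_nat q in B (l, j) k
      | _ => let (N, q) := of_nat n in let (l, j) := of_nat q in c N l j
      end)%nat).
    assert (e1 : forall l j, tree_part h l j = X l j)
      by (intros; unfold tree_part, h; now rewrite !cancel_of_to).
    assert (e2 : forall k, bound_part h k = g k)
      by (intros; unfold bound_part, h; now rewrite !cancel_of_to).
    assert (e3 : forall l j k, oracle_part h l j k = B (l, j) k)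
      by (intros; unfold oracle_part, h; now rewrite !cancel_of_to).
    assert (e4 : forall N l j, cost_part h N l j = c N l j)
      by (intros; unfold cost_part, h; now rewrite !cancel_of_to).
    exists a, h. apply admissible_iff. clearbody h.
    destruct hcost as [h1 [h2 [h3 h4]]].
    split; [intros; rewrite e4; apply h1|].
    split; [intros; rewrite !e4; now apply h2|].
    split; [intros N l j; rewrite e4, e1; apply h3|].
    split; [intros; rewrite e4; apply h4|].
    intros l j. rewrite e1. intros hX.
    destruct (hB' (l, j) hX) as [z [f [hb [hj [hf hn]]]]]. cbn [fst snd] in *.
    assert (e5 : oracle_part h l j = B (l, j)).
    { apply functional_extensionality. apply e3. }
    rewrite e5, hb in *. repeat split.
    + intros k. rewrite joinN_odd, e2. apply hf.
    + intros k _. rewrite joinN_even. apply bseq_le1.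
    + rewrite <- hj. apply binval_ext. intros i _. now rewrite joinN_even.
    + destruct (run (joinN (bseq z) f) l e0 nil) as [|q] eqn:hq; [reflexivity|].
      destruct hn. exists q. now apply (run_sound _ l).
Qed.

(** * Baire category on a closed subset of Baire space *)

Section Category.
Local Open Scope nat_scope.

Lemma agree_trans u a b c : agree u a b -> agree u b c -> agree u a c.
Proof. intros h1 h2 i hi. rewrite h2, h1 by assumption. reflexivity. Qed.

(** If no code succeeded densely in a neighbourhood, then stage [n] could pass to a smaller
    neighbourhood where the code numbered [n] fails at all members. The limit lies in [P] by
    closedness and would satisfy [Q] for no code. *)
Lemma baire_category (P : (nat -> nat) -> Prop) (Q : code -> (nat -> nat) -> Prop) h0 :
  (forall h, (forall u, exists h', P h' /\ agree u h h') -> P h) ->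
  P h0 -> (forall h, P h -> exists e, Q e h) ->
  exists e h m, P h /\ forall h', P h' -> agree m h h' ->
    forall u, exists h'', P h'' /\ agree u h' h'' /\ Q e h''.
Proof.
  intros hclosed h0P hQ. apply NNPP. intros hn.
  assert (step : forall x : nat * ((nat -> nat) * nat), exists y : (nat -> nat) * nat,
    P (fst (snd x)) ->
      P (fst y) /\ snd (snd x) < snd y /\ agree (snd (snd x)) (fst (snd x)) (fst y) /\
      forall e h'', code_number e = fst x -> P h'' -> agree (snd y) (fst y) h'' -> ~ Q e h'').
  { intros [n [h m]]. cbn [fst snd].
    destruct (classic ((exists e, code_number e = n) /\ P h)) as [[[e <-] hP]|hne].
    (* If [n] numbers no code, the stage merely increases the precision. *)
    2:{ exists (h, S m). intros hP. cbn [fst snd]. split; [assumption|]. split; [lia|].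
        split; [now intros i hi|]. intros e h'' he. destruct hne. split; [now exists e|assumption]. }
    apply NNPP. intros hno. apply hn. exists e, h, m. split; [assumption|].
    intros h' hP' ha u. apply NNPP. intros hn2. apply hno. exists (h', S (m + u)).
    intros _. cbn [fst snd]. split; [assumption|]. split; [lia|]. split; [assumption|].
    intros e' h'' he hP'' ha'' hQ''. apply code_number_inj in he. subst e'.
    apply hn2. exists h''. split; [assumption|].
    split; [|assumption]. eapply agree_le; [|exact ha'']. lia. }
  destruct (choice_fun _ step) as [F hF]. clear step hn.
  pose (ys := nat_rect (fun _ => ((nat -> nat) * nat)%type) (h0, 0) (fun n y => F (n, y))).
  assert (hP : forall n, P (fst (ys n))).
  { induction n as [|n IH]; [exact h0P|]. now apply (hF (n, ys n)). }
  assert (hlt : forall n, n <= snd (ys n)).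
  { induction n as [|n IH]; [lia|]. destruct (hF (n, ys n) (hP n)) as [_ [h _]].
    change (snd (ys n) < snd (ys (S n))) in h. lia. }
  assert (hag : forall n k, snd (ys n) <= snd (ys (n + k)) /\
                            agree (snd (ys n)) (fst (ys n)) (fst (ys (n + k)))).
  { intros n k. induction k as [|k [IH1 IH2]].
    - rewrite Nat.add_0_r. split; [lia|now intros i hi].
    - rewrite Nat.add_succ_r.
      destruct (hF (n + k, ys (n + k)) (hP (n + k))) as [_ [h1 [h2 _]]]. cbn [fst snd] in h1, h2.
      change (F (n + k, ys (n + k))) with (ys (S (n + k))) in h1, h2.
      split; [lia|]. apply (agree_trans _ _ _ _ IH2). eapply agree_le; [exact IH1|exact h2]. }
  pose (H := fun i => fst (ys (S i)) i).
  assert (hH : forall n, agree (snd (ys n)) (fst (ys n)) H).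
  { intros n i hi. unfold H. destruct (Nat.le_gt_cases n (S i)) as [hl|hl].
    - replace (S i) with (n + (S i - n)) by lia. now apply hag.
    - replace n with (S i + (n - S i)) by lia. symmetry. apply hag.
      specialize (hlt (S i)). lia. }
  assert (hPH : P H).
  { apply hclosed. intros u. exists (fst (ys u)). split; [apply hP|].
    intros i hi. symmetry. apply hH. specialize (hlt u). lia. }
  destruct (hQ H hPH) as [e he].
  destruct (hF (code_number e, ys (code_number e)) (hP _)) as [_ [_ [_ h]]].
  apply (h e H); try assumption; [reflexivity|]. apply (hH (S (code_number e))).
Qed.

End Category.

Lemma tree_real_continuous h u :
  exists u', forall h', agree u' h h' -> agree u (bseq (tree_real h)) (bseq (tree_real h')).
Proof.
  assert (hb : exists u', forall k, (k < u)%nat -> (to_nat (0, k) < u')%nat).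
  { induction u as [|u [u' IH]]; [exists 0%nat; lia|]. exists (S (u' + to_nat (0, u)))%nat.
    intros k hk. destruct (Nat.eq_dec k u) as [->|]; [lia|]. specialize (IH k). lia. }
  destruct hb as [u' hu']. exists u'. intros h' ha k hk.
  now rewrite !bseq_tree_real, (ha (to_nat (0%nat, k))) by auto.
Qed.

(** * Definability of the values computed in a neighbourhood *)

Section Definability.
Local Open Scope nat_scope.
Variables (p : nat -> nat) (depth : nat) (e0 e : code) (h0 : nat -> nat) (m : nat).
Hypothesis p_comp : Comp 1 (fun _ a => p (hd 0 a)).

(** The function [h0] is arbitrary, but for fixed [q] only finitely many of its values occur, and
    these are written into the code as constants. *)
Lemma comp_initial_gap n (o : (nat -> nat) -> nat -> nat) :
  Comp 1 (fun al a => o al (hd 0 a)) ->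
  forall q, Comp n (fun al _ => bsum (fun k => gap (o al k) (h0 k)) q).
Proof.
  intros ho. induction q as [|q IH]; [exact (comp_const n 0)|].
  apply (comp_add n (fun al _ => gap (o al q) (h0 q))
    (fun al _ => bsum (fun k => gap (o al k) (h0 k)) q)); [|exact IH].
  assert (h : Comp n (fun al _ => o al q)) by (apply (comp_subst _ o); [exact ho|apply comp_const]).
  apply (comp_add n (fun al _ => o al q - h0 q) (fun al _ => h0 q - o al q));
    apply comp_sub; try exact h; apply comp_const.
Qed.

(* The witness function lists the clock of a terminating computation followed by [h]. *)
Lemma computed_value_Sigma11 (i : nat) :
  Sigma11_nat (fun n => exists h t, admissible p depth e0 h /\ agree m h0 h /\
      run (bseq (tree_real h)) t e [n] = S i).
Proof.
  pose (o := fun (al : nat -> nat) k => al (S k)).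
  assert (ho : Comp 1 (fun al a => o al (hd 0 a))) by apply comp_oracle, comp_S, comp_hd.
  destruct (comp_search 1 (fun al a =>
    bsum (fun N => bsum (fun l => bsum (fun j => bsum (fun k =>
      defect p depth e0 (o al) N l j k) (nth 0 a 0)) (nth 0 a 0)) (nth 0 a 0)) (nth 0 a 0) +
    (bsum (fun k => gap (o al k) (h0 k)) m +
    gap (run (bseq (tree_real (o al))) (al 0) e [nth 1 a 0]) (S i)))) as [c hc].
  { apply comp_add; [|apply comp_add].
    - repeat (apply comp_bsum; [comp_step|]).
      apply (comp_defect p depth e0 p_comp _ o); [exact ho| | | |]; comp_step.
    - now apply comp_initial_gap.
    - assert (hr : Comp 2 (fun al a => run (bseq (tree_real (o al))) (al 0) e [nth 1 a 0])).
      { apply (comp_run e 2 (fun al _ => bseq (tree_real (o al))) (fun al _ => al 0)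
          [fun _ a => nth 1 a 0]).
        - eapply comp_ext; [intros al a _; symmetry; apply bseq_tree_real|].
          apply comp_sub; [comp_step|]. apply comp_sub; [comp_step|].
          apply (comp_subst _ o); [exact ho|]. repeat comp_step.
        - apply comp_oracle, comp_const.
        - repeat constructor. apply comp_nth. }
      apply (comp_add 2 (fun al a => run (bseq (tree_real (o al))) (al 0) e [nth 1 a 0] - S i)
        (fun al a => S i - run (bseq (tree_real (o al))) (al 0) e [nth 1 a 0]));
        apply comp_sub; try exact hr; apply comp_const. }
  exists c. intros n.
  (* The search variable [t] bounds all four indices at once, so vanishing for every [t] is the
     unbounded quantifier. *)
  assert (hbsum4 : forall D : nat -> nat -> nat -> nat -> nat,
    (forall t, bsum (fun N => bsum (fun l => bsum (fun j => bsum (fun k => D N l j k) t) t) t) t = 0)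
    <-> forall N l j k, D N l j k = 0).
  { intros D. split.
    - intros H N l j k. specialize (H (S (N + l + j + k))).
      rewrite bsum_eq0 in H. specialize (H N ltac:(lia)). rewrite bsum_eq0 in H.
      specialize (H l ltac:(lia)). rewrite bsum_eq0 in H. specialize (H j ltac:(lia)).
      rewrite bsum_eq0 in H. apply H. lia.
    - intros H t. apply bsum_eq0. intros N _. apply bsum_eq0. intros l _.
      apply bsum_eq0. intros j _. apply bsum_eq0. intros k _. apply H. }
  assert (hagree : forall h, bsum (fun k => gap (h k) (h0 k)) m = 0 <-> agree m h0 h).
  { intros h. rewrite bsum_eq0. unfold agree. now setoid_rewrite gap_eq0. }
  transitivity (exists f : nat -> nat, admissible p depth e0 (o f) /\ agree m h0 (o f) /\
     run (bseq (tree_real (o f))) (f 0) e [n] = S i).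
  - split.
    + intros [h [t H]]. now exists (fun k => match k with 0 => t | S k => h k end).
    + intros [f H]. now exists (o f), (f 0).
  - apply Morphisms_Prop.ex_iff_morphism. intros f. rewrite (hc f [n] eq_refl). cbn [nth].
    unfold admissible. rewrite <- hbsum4, <- hagree,
      <- (gap_eq0 (run (bseq (tree_real (o f))) (f 0) e [n])). split.
    + intros [h1 [h2 h3]] [t ht]. apply ht. now rewrite h1, h2, h3.
    + intros H.
      assert (H' : forall t, bsum (fun N => bsum (fun l => bsum (fun j => bsum (fun k =>
          defect p depth e0 (o f) N l j k) t) t) t) t = 0 /\
          bsum (fun k => gap (o f k) (h0 k)) m = 0 /\
          gap (run (bseq (tree_real (o f))) (f 0) e [n]) (S i) = 0).
      { intros t. destruct (Nat.eq_dec (bsum (fun N => bsum (fun l => bsum (fun j => bsum (fun k =>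
          defect p depth e0 (o f) N l j k) t) t) t) t +
          (bsum (fun k => gap (o f k) (h0 k)) m +
          gap (run (bseq (tree_real (o f))) (f 0) e [n]) (S i))) 0) as [h|h].
        - rewrite !Nat.eq_add_0 in h. exact h.
        - destruct H. now exists t. }
      split; [intros t; apply H'|]. split; apply (H' 0).
Qed.

End Definability.

(** * Rational dimension and conclusion *)

Lemma floor_mul_bounds u v s l :
  (0 < v)%nat -> s * INR v = INR u ->
  INR (floor_mul u v l) <= s * INR l /\ s * INR l < INR (floor_mul u v l) + 1.
Proof.
  intros hv hs. rewrite floor_mul_spec by assumption.
  pose proof (Nat.div_mod_eq (u * l) v) as h.
  pose proof (Nat.mod_upper_bound (u * l) v ltac:(lia)) as hm.
  apply lt_INR in hm. apply (f_equal INR) in h. rewrite plus_INR, !mult_INR, <- hs in h.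
  pose proof (pos_INR ((u * l) mod v)). apply lt_INR in hv. change (INR 0) with 0 in hv.
  split.
  - apply (Rmult_le_reg_l (INR v)); [assumption|]. lra.
  - apply (Rmult_lt_reg_l (INR v)); [assumption|]. lra.
Qed.

Lemma rational_ratio s :
  (exists q : Q, s = Q2R q) -> 0 < s -> exists u v, (0 < v)%nat /\ s * INR v = INR u.
Proof.
  intros [q ->] hs. exists (Z.to_nat (Qnum q)), (Pos.to_nat (Qden q)).
  split; [apply Pos2Nat.is_pos|]. unfold Q2R in *.
  assert (hd : 0 < IZR (Zpos (Qden q))) by (apply IZR_lt; reflexivity).
  assert (hn : 0 < IZR (Qnum q)).
  { apply (Rmult_lt_reg_r (/ IZR (Zpos (Qden q)))); [now apply Rinv_0_lt_compat|lra]. }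
  rewrite !INR_IZR_INZ, positive_nat_Z, Z2Nat.id by (apply lt_IZR in hn; lia).
  field. lra.
Qed.

Theorem mainTheorem15 (s : R) (E : cantor -> Prop) (y : cantor) :
  (exists q : Q, s = Q2R q) -> 0 < s < 1 ->
  Sigma11_class E -> Hs_pos s E ->
  (forall x : cantor,
     (exists P : cantor -> Prop,
        (forall z, P z -> E z) /\ Pi01_rel x P /\ Hs_pos s P) ->
     turing_le y x) ->
  hyperarithmetic y.
Proof.
  intros hq [hs _] [e0 hE] hpos hy.
  destruct (rational_ratio s hq hs) as [u [v [hv huv]]].
  set (p := floor_mul u v).
  assert (hp1 : forall l, INR (p l) <= s * INR l) by (intros l; now apply floor_mul_bounds).
  assert (hp2 : forall l, s * INR l < INR (p l) + 1) by (intros l; now apply floor_mul_bounds).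
  assert (hp : Comp 1 (fun _ a => p (hd 0%nat a))) by apply comp_floor_mul.
  destruct (admissible_exists s p e0 E hs hp1 hp2 hE hpos) as [depth [h1 hh1]].
  (* The paths of an admissible tree form a subclass of [E] as in the hypothesis on [y], with the
     tree as oracle. *)
  assert (hred : forall h, admissible p depth e0 h ->
    exists e, forall n, eval (bseq (tree_real h)) e [n] (bseq y n)).
  { intros h hh. apply (hy (tree_real h)). exists (tree_class (tree_part h)).
    split; [intros z hz; apply hE; now apply (tree_class_witness p depth e0 h)|].
    split; [apply tree_class_Pi01|].
    apply admissible_iff in hh. destruct hh as [c1 [c2 [c3 [c4 _]]]].
    now apply (tree_class_Hs_pos s p hs hp1 hp2 _ (cost_part h) depth). }
  destruct (baire_category (admissible p depth e0) _ h1
    (admissible_closed p depth e0 hp) hh1 hred) as [e [h0 [m [hh0 hdense]]]].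
  assert (hval : forall i n, bseq y n = i <->
    exists h t, admissible p depth e0 h /\ agree m h0 h /\
      run (bseq (tree_real h)) t e [n] = S i).
  { intros i n. split.
    (* Density near [h0] itself supplies a member on which [e] computes [y]. *)
    - intros <-. destruct (hdense h0 hh0 (fun _ _ => eq_refl) m) as [h [hh [ha he]]].
      destruct (eval_run _ _ _ _ (he n)) as [t ht]. exists h, t.
      split; [assumption|]. split; [assumption|]. apply ht; [lia|now intros j hj].
    (* On [h] the machine need not compute [y], but this one output depends on finitely many values
       of [h]. Density gives a member [h'] sharing them on which [e] does compute [y], so
       determinism identifies the output. *)
    - intros [h [t [hh [ha hr]]]]. apply run_sound in hr.
      destruct (eval_run _ _ _ _ hr) as [w hw].
      destruct (tree_real_continuous h w) as [w' hw'].
      destruct (hdense h hh ha w') as [h' [_ [ha' he]]].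
      apply (eval_det (bseq (tree_real h')) e [n]); [apply he|].
      apply (run_sound _ w), hw; [lia|]. now apply hw'. }
  assert (hS : forall b, Sigma11_nat (fun n => y n = b)).
  { intros b.
    destruct (computed_value_Sigma11 p depth e0 e h0 m hp (if b then 1 else 0)%nat) as [c hc].
    exists c. intros n. rewrite <- hc, <- hval. unfold bseq. now destruct (y n), b. }
  split; apply hS.
Qed.
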